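(* Let $p,q\in[1,\infty)$, $\alpha\in\mathbb{R}$, let $Q_0$ be a cube of $\mathbb{R}^n$ with edge length $\ell_0$, and let $\widetilde Q_0:=Q_0\times[t_0,t_0+\ell_0]$ for any given $t_0\in\mathbb{R}$. Let $f$ be a measurable function on $Q_0$, and $F(x,t):=f(x)$ for any $(x,t)\in\widetilde Q_0$. Then $F$ is a measurable function on $\widetilde Q_0$, and $$F\in JNQ^{\alpha}_{p,q}(\widetilde Q_0)\Longleftrightarrow f\in JNQ^{\alpha}_{p,q}(Q_0).$$ Moreover, $\|F\|_{JNQ^{\alpha}_{p,q}(\widetilde Q_0)}\sim\ell_0^{1/p}\|f\|_{JNQ^{\alpha}_{p,q}(Q_0)}$ with the positive equivalence constants independent of $f$, $F$, and $Q_0$.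
   Context: Here $n\in\mathbb{N}$, $n\ge1$. A measurable function is a Lebesgue measurable function that is finite almost everywhere. A cube has finite positive edge length and all its edges parallel to the coordinate axes, and need not be open or closed. For any dimension $d\ge1$, any cube $Q_0\subset\mathbb{R}^d$, and any measurable function $f$ on $Q_0$, $$\|f\|_{JNQ^{\alpha}_{p,q}(Q_0)}:=\sup\Big\{\sum_j|Q_j|\Big[|Q_j|^{\frac{q\alpha}{d}-1}\int_{Q_j}\int_{Q_j}\frac{|f(x)-f(y)|^q}{|x-y|^{d+q\alpha}}\,dy\,dx\Big]^{p/q}\Big\}^{1/p},$$ where the supremum is taken over all collections $\{Q_j\}_j$ of subcubes of $Q_0$ with pairwise disjoint interiors, and $JNQ^{\alpha}_{p,q}(Q_0)$ is the set of all measurable $f$ on $Q_0$ with $\|f\|_{JNQ^{\alpha}_{p,q}(Q_0)}<\infty$. The space on $Q_0$ in the claim is taken with $d=n$, and the one on $\widetilde Q_0$ with $d=n+1$. $A\sim B$ means $c^{-1}A\le B\le cA$ for a positive constant $c$. *)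

(* Defs.v *)
From HB Require Import structures.
From mathcomp Require Import all_boot all_order all_algebra.
From mathcomp Require Import all_classical all_reals all_analysis
  measurable_realfun.

Set Implicit Arguments.
Unset Strict Implicit.
Unset Printing Implicit Defensive.
Import Order.TTheory GRing.Theory Num.Theory.
Import numFieldNormedType.Exports.

Local Open Scope classical_set_scope.
Local Open Scope ring_scope.

Definition rcons_pair (R : realType) (d : nat)
    (xt : d.-tuple (measurableTypeR R) * measurableTypeR R) :
    d.+1.-tuple (measurableTypeR R) :=
  rcons_tuple xt.1 xt.2.

Lemma measurable_rcons_pair (R : realType) (d : nat) :
  measurable_fun setT (@rcons_pair R d).
Proof.
apply/measurable_fun_tnthP => i.
have [id|di] := ltnP i d.
- rewrite (_ : _ \o _ = (fun x : d.-tuple (measurableTypeR R) =>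
      tnth x (Ordinal id)) \o fst); last first.
    apply/funext => -[x t] /=.
    by rewrite !(tnth_nth t) /= nth_rcons size_tuple id.
  by apply: measurableT_comp => //; exact: measurable_tnth.
- rewrite (_ : _ \o _ = snd); first exact: measurable_snd.
  apply/funext => -[x t] /=.
  have /eqP id : i == d :> nat by rewrite eqn_leq di -ltnS ltn_ord.
  by rewrite (tnth_nth t) /= nth_rcons size_tuple id ltnn eqxx.
Qed.

Section product_lebesgue.
Context {R : realType} {d : nat}.
Variable m : {measure set (d.-tuple (measurableTypeR R)) -> \bar R}.
Local Open Scope ereal_scope.

Definition product_lebesgue :
    set (d.+1.-tuple (measurableTypeR R)) -> \bar R :=
  pushforward (m \x lebesgue_measure) (@rcons_pair R d).

Let product_lebesgue0 : product_lebesgue set0 = 0.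
Proof. by apply: measure0; exact: measurable_rcons_pair. Qed.

Let product_lebesgue_ge0 A : 0 <= product_lebesgue A.
Proof. by apply: measure_ge0; exact: measurable_rcons_pair. Qed.

Let product_lebesgue_sigma_additive : semi_sigma_additive product_lebesgue.
Proof.
apply: measure_semi_sigma_additive; exact: measurable_rcons_pair.
Qed.

HB.instance Definition _ := isMeasure.Build _ _ _ product_lebesgue
  product_lebesgue0 product_lebesgue_ge0 product_lebesgue_sigma_additive.

End product_lebesgue.

(* Lebesgue measure on the Borel sets of R^d: the d-fold product of the
   one-dimensional Lebesgue measure, R^(d+1) being identified with R^d * R by
   appending the last coordinate. *)
Fixpoint borel_lebesgue (R : realType) (d : nat) :
    {measure set (d.-tuple (measurableTypeR R)) -> \bar R} :=
  match d with
  | 0 => dirac [tuple]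
  | d'.+1 => product_lebesgue (borel_lebesgue R d')
  end.

(* R^d with the sigma-algebra of Lebesgue measurable sets, that is, the sets
   that are Caratheodory measurable for the outer measure induced by
   borel_lebesgue. *)
Definition Rn (R : realType) (d : nat) : Type :=
  caratheodory_type ((borel_lebesgue R d)^*)%mu.

HB.instance Definition _ (R : realType) (d : nat) :=
  Measurable.on (Rn R d).

Definition lebesgue (R : realType) (d : nat) : {measure set (Rn R d) -> \bar R} :=
  @completed_measure_extension _ _ _ (borel_lebesgue R d).

Section JNQ.
Context {R : realType} {d : nat}.
Implicit Types (Q : set (Rn R d)) (C : set (set (Rn R d)))
  (f : Rn R d -> \bar R).

Definition coor (x : Rn R d) (i : 'I_d) : R := tnth (x : d.-tuple R) i.

Definition edist (x y : Rn R d) : R :=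
  Num.sqrt (\sum_(i < d) (coor x i - coor y i) ^+ 2).

(* A product of intervals of length l; each of the 2d faces may independently
   belong to Q or not. *)
Definition is_cube Q (l : R) : Prop :=
  0 < l /\ exists (a : 'I_d -> R) (lo hi : 'I_d -> bool),
    Q = [set x | forall i,
      coor x i \in Interval (BSide (lo i) (a i)) (BSide (hi i) (a i + l))].

(* Topological interior, taken in the row vectors, where the library has the
   topology of R^d. *)
Definition interior_in_rV Q : set 'rV[R]_d :=
  interior [set \row_i coor x i | x in Q].

(* A family of cubes with pairwise disjoint interiors has no repetitions, so
   that it is the same as a set of cubes. *)
Definition subcube_collection (Q0 : set (Rn R d)) C : Prop :=
  (forall Q, C Q -> (exists l, is_cube Q l) /\ Q `<=` Q0) /\
  (forall Q Q', C Q -> C Q' -> Q <> Q' ->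
     interior_in_rV Q `&` interior_in_rV Q' = set0).

Definition lebesgue_function Q f : Prop :=
  measurable_fun Q f /\
  {ae lebesgue R d, forall x, Q x -> f x \is a fin_num}.

Local Open Scope ereal_scope.

(* On the diagonal the kernel is 0^-1 = 0 or 1, depending on the exponent; this
   is immaterial, as the diagonal is negligible.  So is the value of f x - f y
   where f is infinite. *)
Definition JNQ_energy (q alpha : R) f Q : \bar R :=
  \int[lebesgue R d]_(x in Q) \int[lebesgue R d]_(y in Q)
    (`|f x - f y| `^ q * ((edist x y `^ (d%:R + q * alpha))^-1)%:E).

Definition JNQ_sum (p q alpha : R) f C : \bar R :=
  \esum_(Q in C)
    (lebesgue R d Q *
     (lebesgue R d Q `^ (q * alpha / d%:R - 1) * JNQ_energy q alpha f Q)
       `^ (p / q)).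

Definition JNQ_norm (p q alpha : R) (Q0 : set (Rn R d)) f : \bar R :=
  ereal_sup [set JNQ_sum p q alpha f C | C in subcube_collection Q0] `^ (p^-1).

Definition JNQ (p q alpha : R) (Q0 : set (Rn R d)) : set (Rn R d -> \bar R) :=
  [set f | lebesgue_function Q0 f /\ JNQ_norm p q alpha Q0 f < +oo].

End JNQ.

Definition pair_Rn {R : realType} {d : nat} (x : Rn R d) (t : R) : Rn R d.+1 :=
  rcons_tuple (x : d.-tuple R) t.

Definition cylinder {R : realType} {d : nat} (Q : set (Rn R d)) (I : set R) :
    set (Rn R d.+1) :=
  [set pair_Rn x t | x in Q & t in I].

(* Main.v *)
Require Import Defs.
From HB Require Import structures.
From mathcomp Require Import all_boot all_order all_algebra.
From mathcomp Require Import all_classical all_reals all_analysis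
  measurable_realfun.
From mathcomp Require Import ring lra.
Set Implicit Arguments.
Unset Strict Implicit.
Unset Printing Implicit Defensive.
Import Order.TTheory GRing.Theory Num.Theory.
Import numFieldNormedType.Exports.
Local Open Scope classical_set_scope.
Local Open Scope ring_scope.

(** Write [s = n + q * alpha] and [K (x, y) = |f x - f y| ^ q], so that the
    energy of [f] on a cube [Q] of R^n is the double integral over [Q] of
    [K (x, y) |x - y| ^ - s].  As [F] is constant in [t], its energy on
    [Q x I], where [I] has the same length [l] as the edges of [Q], is the
    integral of [K (x, y) (|x - y|^2 + (t - u)^2) ^ - ((s + 1) / 2)].
    The proof has two independent parts.

    The energy of [F] on [Q x I] is comparable to [l] times the energy of [f]
    on [Q].  The integral over [u] in [I] of the kernel of [F] is always at
    least [c |x - y| ^ - s], because [I] contains an interval of length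
    comparable to [|x - y|] at distance at most [|x - y|] from [t]
    ([riesz_fiber_ge]); for [s > 0] it is also at most [C |x - y| ^ - s]
    ([riesz_fiber_le]), and the comparison is then pointwise.  For [s <= 0]
    the pointwise upper bound fails: when [s = 0] the integral over [u] is of
    the order of [1 + log (l / |x - y|)].  It is still at most
    [C l ^ (1/2 - s) |x - y| ^ (- 1/2)], and the singular weight is removed by
    averaging ([triple_integral]): [K (x, y)] is at most a constant times
    [K (x, z) + K (y, z)] for every [z], at least half of the points [z] of
    [Q] lie at distance at least [l / 8] from both [x] and [y], and the weight
    is integrable in [x] and in [y].  What remains is the integral of [K] over
    the pairs at distance comparable to [l], where all powers of the distance
    are comparable to the same powers of [l].  Together with the scaling of
    the prefactors this shows that the summand of [F] for [Q x I] is
    comparable to [l] times the summand of [f] for [Q] ([JNQ_term_lift]).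

    It remains to compare the families of cubes.  Given a family of cubes
    [Q_k x I_k] of the cylinder, the [Q_k] whose [I_k] contains [t] in its
    interior form a family of cubes of [Q_0] with disjoint interiors, for each
    fixed [t]; integrating the corresponding sum over [t] produces the sum of
    [l_k] times the summand of [Q_k], which is therefore at most [l_0] times
    the supremum for [f] ([family_sup_cyl_le]).  Conversely, above every cube
    [Q] of a family in [Q_0] one stacks [floor (l_0 / l)] cubes, whose heights
    add up to at least [l_0 / 2] ([family_sup_cyl_ge]).

    Lebesgue measurable sets are Caratheodory sets, so that the sigma-algebra
    of R^(n+1) is larger than the product of those of R^n and R.  All the
    integrands above are measurable for the product, and for such functions
    Lebesgue measure on R^(n+1) may be replaced by the product measure, to
    which Tonelli's theorem applies ([integral_split_Rn]). *)

(** * Caratheodory measurable sets are Borel up to null sets *)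
Section hull.
Context d (T : measurableType d) (R : realType).
Variable mu : {measure set T -> \bar R}.
Local Open Scope ereal_scope.
Local Notation C := (caratheodory_type (mu^*)%mu).
Local Notation mubar := (@completed_measure_extension _ _ _ mu).

(** The intersection of covers whose measures approach the outer measure. *)
Lemma outer_measurable_hull (X : set T) : (mu^*)%mu X < +oo ->
  exists G : set T, [/\ measurable G, X `<=` G & mu G = (mu^*)%mu X].
Proof.
move=> Xoo.
have Xfin : (mu^*)%mu X \is a fin_num by rewrite ge0_fin_numE// outer_measure_ge0.
have cov n : exists G : set T, [/\ measurable G, X `<=` G &
    mu G < (mu^*)%mu X + n.+1%:R^-1%:E].
  have n0 : (0 < n.+1%:R^-1 :> R)%R by rewrite invr_gt0.
  have [_ [A [mA XA] <-] lA] := lb_ereal_inf_adherent n0 Xfin.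
  exists (\bigcup_k A k); split => //; first exact: bigcupT_measurable.
  apply: le_lt_trans lA.
  exact: (measure_sigma_subadditive mu mA (bigcupT_measurable _ mA)).
have [G HG] := choice cov.
have mG : measurable (\bigcap_n G n).
  by apply: bigcapT_measurable => n; have [] := HG n.
have XG : X `<=` \bigcap_n G n by move=> x Xx n _; have [_ + _] := HG n; apply.
exists (\bigcap_n G n); split => //.
apply/eqP; rewrite eq_le; apply/andP; split; last first.
  by rewrite -(measurable_mu_extE mu mG) le_outer_measure.
apply/lee_addgt0Pr => _/posnumP[e]; near \oo => n.
have [mGn XGn ltG] := HG n.
apply: (@le_trans _ _ (mu (G n))).
  by apply: le_measure; rewrite ?inE//; exact: bigcap_inf.
rewrite (le_trans (ltW ltG))// leeD// lee_fin ltW//.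
by near: n; apply: near_infty_natSinv_lt.
Unshelve. all: by end_near. Qed.

(** A piece of [A] of finite measure is its hull [G] minus [G \ A], and
    [G \ A] has outer measure 0 because [A] splits [G] additively; removing a
    null hull of [G \ A] from [G] leaves a measurable subset of [A]. *)
Lemma caratheodory_borel_hull (A : set C) : sigma_finite setT mu -> measurable A ->
  exists B N : set T, [/\ measurable B, measurable N, mu N = 0,
    B `<=` A & A `\` B `<=` N].
Proof.
move=> [F TF Ffin] mA.
have fin k : exists BN : set T * set T, [/\ measurable BN.1, measurable BN.2,
    mu BN.2 = 0, BN.1 `<=` A & (A `&` F k) `\` BN.1 `<=` BN.2].
  have [mF Foo] := Ffin k.
  have mFC : measurable (F k : set C) by exact: caratheodory_measurable_mu_ext.
  have mAF : measurable ((A `&` F k) : set C) by exact: measurableI.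
  have AFoo : (mu^*)%mu (A `&` F k) < +oo.
    apply: le_lt_trans Foo; rewrite -(measurable_mu_extE mu mF).
    by apply: le_outer_measure; exact: subIsetr.
  have [G [mG AG GE]] := outer_measurable_hull AFoo.
  have mGC : measurable (G : set C) by exact: caratheodory_measurable_mu_ext.
  have D0 : (mu^*)%mu (G `\` (A `&` F k)) = 0.
    have /= : (mu^*)%mu (G `\` (A `&` F k)) =
        (mu^*)%mu G - (mu^*)%mu (G `&` (A `&` F k)).
      apply: (@measureD _ C R mubar) => //=.
      by rewrite /completed_measure_extension (measurable_mu_extE mu mG) GE.
    rewrite (setIidr AG) (measurable_mu_extE mu mG) GE => ->; rewrite subee//.
    by rewrite ge0_fin_numE// outer_measure_ge0.
  have [|N [mN DN NE]] := @outer_measurable_hull (G `\` (A `&` F k)); first by rewrite D0.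
  exists (G `\` N, N); split => //=.
  - exact: measurableD.
  - by rewrite NE D0.
  - move=> x [Gx Nx]; apply: contrapT => Ax; apply: Nx; apply: DN; split => //.
    by case.
  - by move=> x [AFx GNx]; apply: contrapT => Nx; apply: GNx; split => //; exact: AG.
have [BN HBN] := choice fin.
exists (\bigcup_k (BN k).1), (\bigcup_k (BN k).2); split.
- by apply: bigcupT_measurable => k; have [] := HBN k.
- by apply: bigcupT_measurable => k; have [] := HBN k.
- apply/eqP; rewrite eq_le measure_ge0 andbT.
  have mN k : measurable (BN k).2 by have [] := HBN k.
  apply: le_trans (measure_sigma_subadditive mu mN (bigcupT_measurable _ mN)
    (@subset_refl _ _)) _.
  by rewrite eseries0// => k _ _; have [] := HBN k.
- by move=> x [k _ Bx]; have [_ _ _ + _] := HBN k; apply.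
- move=> x [Ax Bx]; have : (\bigcup_k F k) x by rewrite -TF.
  move=> [k _ Fx]; exists k => //; have [_ _ _ _] := HBN k; apply; split => //.
  by move=> Bkx; apply: Bx; exists k.
Qed.

Lemma completed_measureE (A : set C) (B N : set T) : measurable A -> measurable B ->
  measurable N -> mu N = 0 -> B `<=` A -> A `\` B `<=` N -> mubar A = mu B.
Proof.
move=> mA mB mN N0 BA ABN; apply/eqP; rewrite eq_le; apply/andP; split.
- rewrite -(adde0 (mu B)) -N0 -(measurable_mu_extE mu mB).
  rewrite -(measurable_mu_extE mu mN); apply: le_trans (outer_measureU2 _ _ _).
  apply: le_outer_measure => x Ax; have [Bx|nBx] := pselect (B x); [by left|].
  by right; apply: ABN.
- by rewrite -(measurable_mu_extE mu mB); apply: le_outer_measure.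
Qed.

Lemma caratheodory_of_borel (A : set C) (B N : set T) : measurable B ->
  measurable N -> mu N = 0 -> B `<=` A -> A `\` B `<=` N -> measurable A.
Proof.
move=> mB mN N0 BA ABN; rewrite -(setUIDK A B) (setIidr BA).
apply: measurableU; first exact: caratheodory_measurable_mu_ext.
apply: (@measure_is_complete_caratheodory _ _ (mu^*)%mu).
exists N; split => //; first exact: caratheodory_measurable_mu_ext.
by have /= := measurable_mu_extE mu mN; rewrite N0.
Qed.

End hull.

(** * Lebesgue measure on R^(n+1) as a product *)
Section pack_sigma_finite.
Context d (T : measurableType d) (R : realType).
Variable mu : {measure set T -> \bar R}.
Hypothesis mu_sf : sigma_finite setT mu.

Let pack_fun : set T -> \bar R := mu.
HB.instance Definition _ := Measure.copy pack_fun mu.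
HB.instance Definition _ := Measure_isSigmaFinite.Build _ _ _ pack_fun mu_sf.
Definition sigma_finite_pack : {sigma_finite_measure set T -> \bar R} := pack_fun.

End pack_sigma_finite.

Lemma ord_maxP n (i : 'I_n.+1) : (n <= i)%N -> i = ord_max.
Proof.
by move=> ni; apply: val_inj; apply/eqP; rewrite eqn_leq ni -ltnS ltn_ord.
Qed.

Section split_last.
Context {R : realType} {n : nat}.
Local Notation B d := (d.-tuple (measurableTypeR R)).

Definition split_tuple (x : B n.+1) : B n * measurableTypeR R :=
  ([tuple tnth x (widen_ord (leqnSn n) i) | i < n], tnth x ord_max).

Lemma tnth_rcons_widen (x : n.-tuple R) (t : R) (i : 'I_n) :
  tnth (rcons_tuple x t) (widen_ord (leqnSn n) i) = tnth x i.
Proof. by rewrite !(tnth_nth t) /= nth_rcons size_tuple ltn_ord. Qed.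

Lemma tnth_rcons_max (x : n.-tuple R) (t : R) :
  tnth (rcons_tuple x t) ord_max = t.
Proof. by rewrite (tnth_nth t) /= nth_rcons size_tuple ltnn eqxx. Qed.

Lemma split_rcons_pair (y : B n * measurableTypeR R) :
  split_tuple (rcons_pair y) = y.
Proof.
case: y => x t; rewrite /split_tuple /rcons_pair /=; congr (_, _).
  by apply: eq_from_tnth => i; rewrite tnth_mktuple tnth_rcons_widen.
exact: tnth_rcons_max.
Qed.

Lemma rcons_pair_split (x : B n.+1) : rcons_pair (split_tuple x) = x.
Proof.
apply: eq_from_tnth => i; rewrite /rcons_pair /split_tuple /=.
have [id|di] := ltnP i n.
  have -> : i = widen_ord (leqnSn n) (Ordinal id) by exact: val_inj.
  by rewrite tnth_rcons_widen tnth_mktuple.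
by rewrite (ord_maxP di); exact: tnth_rcons_max.
Qed.

Lemma measurable_split_tuple : measurable_fun setT split_tuple.
Proof.
apply/measurable_fun_pairP; split => /=; last exact: measurable_tnth.
apply/measurable_fun_tnthP => i.
rewrite (_ : _ \o _ = (fun x : B n.+1 => tnth x (widen_ord (leqnSn n) i))).
  exact: measurable_tnth.
by apply/funext => x /=; rewrite tnth_mktuple.
Qed.

Lemma borel_lebesgue_rectangle (B : set (n.-tuple (measurableTypeR R)))
    (I : set (measurableTypeR R)) : measurable B -> measurable I ->
  measurable (split_tuple @^-1` (B `*` I)) /\
  borel_lebesgue R n.+1 (split_tuple @^-1` (B `*` I)) =
    (borel_lebesgue R n B * lebesgue_measure I)%E.
Proof.
move=> mB mI; split.
  rewrite -[X in measurable X]setTI; apply: measurable_split_tuple => //.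
  exact: measurableX.
rewrite -product_measure1E//.
rewrite /= /product_lebesgue /pushforward; congr ((_ \x _)%E _).
by apply/funext => y; rewrite /preimage /mkset split_rcons_pair.
Qed.

End split_last.

Section borel_sigma_finite.
Context (R : realType).

(** R^d is exhausted by the boxes of half-width [k] centred at 0. *)
Lemma sigma_finite_borel_lebesgue d : sigma_finite setT (borel_lebesgue R d).
Proof.
pose box d k : set (d.-tuple (measurableTypeR R)) :=
  [set x | forall i, `|tnth x i| <= k%:R].
have boxP k : forall d, measurable (box d k) /\
    (borel_lebesgue R d (box d k) < +oo)%E.
  elim=> [|{}d [mB Boo]].
    have -> : box 0%N k = setT by apply/seteqP; split => // x _ [].
    by split => //; rewrite /= diracT ltry.
  pose J : set (measurableTypeR R) := `[- k%:R, k%:R]%classic.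
  have -> : box d.+1 k = split_tuple @^-1` (box d k `*` J).
    apply/seteqP; split => x /=.
      move=> Hx; split => [i|]; first by rewrite tnth_mktuple.
      by rewrite /J /= in_itv/= -ler_norml.
    rewrite /J /= in_itv/= -ler_norml => -[Hx xk] i.
    have [id|di] := ltnP i d; last by rewrite (ord_maxP di).
    have := Hx (Ordinal id); rewrite tnth_mktuple; congr (`|tnth x _| <= _).
    exact: val_inj.
  have mJ : measurable J by exact: measurable_itv.
  have [mBJ ->] := borel_lebesgue_rectangle mB mJ.
  split => //; apply: lte_mul_pinfty => //; first by rewrite ge0_fin_numE.
  by rewrite lebesgue_measure_itv/=; case: ifP => _; rewrite -?EFinB ltry.
exists (box d) => [|k]; last exact: boxP.
apply/seteqP; split => // x _.
exists (Num.truncn (\sum_(i < d) `|tnth x i|)).+1 => // i.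
apply: (@le_trans _ _ (\sum_(i < d) `|tnth x i|)); last exact/ltW/truncnS_gt.
by rewrite (bigD1 i)//= lerDl sumr_ge0.
Qed.

Lemma sigma_finite_lebesgue d : sigma_finite setT (lebesgue R d).
Proof.
exact: (completed_measure_extension_sigma_finite
  (sigma_finite_borel_lebesgue d)).
Qed.

(** The same measure as [lebesgue], bundled with its sigma-finiteness, which
    Tonelli's theorem requires. *)
Definition sf_lebesgue d : {sigma_finite_measure set (Rn R d) -> \bar R} :=
  sigma_finite_pack (sigma_finite_lebesgue d).

End borel_sigma_finite.

Section Rn_facts.
Context {R : realType}.

Lemma measurable_borel_Rn d (A : set (d.-tuple (measurableTypeR R))) :
  measurable A -> measurable (A : set (Rn R d)).
Proof. exact: caratheodory_measurable_mu_ext. Qed.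

Lemma lebesgue_borelE d (A : set (d.-tuple (measurableTypeR R))) :
  measurable A -> lebesgue R d A = borel_lebesgue R d A.
Proof. exact: measurable_mu_extE. Qed.

Lemma measurable_fun_borel_Rn d d' (T : measurableType d')
    (f : d.-tuple (measurableTypeR R) -> T) :
  measurable_fun setT f -> measurable_fun setT (f : Rn R d -> T).
Proof.
by move=> mf _ Y mY; apply: measurable_borel_Rn; exact: mf.
Qed.

Lemma measurable_coor d (i : 'I_d) : measurable_fun setT (@coor R d ^~ i).
Proof. by apply: measurable_fun_borel_Rn; exact: measurable_tnth. Qed.

Context {n : nat}.

Definition split_Rn (x : Rn R n.+1) : Rn R n * measurableTypeR R :=
  @split_tuple R n x.

Lemma split_pair_Rn (x : Rn R n) (t : R) : split_Rn (pair_Rn x t) = (x, t).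
Proof. exact: (@split_rcons_pair R n (x, t)). Qed.

Lemma pair_split_Rn (x : Rn R n.+1) :
  pair_Rn (split_Rn x).1 (split_Rn x).2 = x.
Proof. exact: (@rcons_pair_split R n x). Qed.

(** It suffices to replace [A] by a Borel set up to a null set [N], as
    [N x R] is null. *)
Lemma lebesgue_rectangle (A : set (Rn R n)) (I : set (measurableTypeR R)) :
  measurable A -> measurable I ->
  measurable (split_Rn @^-1` (A `*` I)) /\
  lebesgue R n.+1 (split_Rn @^-1` (A `*` I)) =
    (lebesgue R n A * lebesgue_measure I)%E.
Proof.
move=> mA mI.
have [B [N [mB mN N0 BA ABN]]] := caratheodory_borel_hull (@sigma_finite_borel_lebesgue R n) mA.
have [mBI BIE] := borel_lebesgue_rectangle mB mI.
have [mNI NIE] := borel_lebesgue_rectangle mN (@measurableT _ (measurableTypeR R)).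
have NI0 : borel_lebesgue R n.+1 (@split_tuple R n @^-1` (N `*` setT)) = 0%E.
  by rewrite NIE [X in (X * _)%E]N0 mul0e.
have sub1 : @split_tuple R n @^-1` (B `*` I) `<=` split_Rn @^-1` (A `*` I).
  by move=> x [] /BA Ax Ix; split.
have sub2 : (split_Rn @^-1` (A `*` I)) `\` (@split_tuple R n @^-1` (B `*` I))
    `<=` @split_tuple R n @^-1` (N `*` setT).
  by move=> x [[Ax Ix] nB]; split => //; apply: ABN; split => // Bx; exact: nB.
have mAI := caratheodory_of_borel mBI mNI NI0 sub1 sub2.
split; first exact: mAI.
transitivity (borel_lebesgue R n.+1 (@split_tuple R n @^-1` (B `*` I))).
  exact: (completed_measureE mAI mBI mNI NI0 sub1 sub2).
by rewrite BIE; congr (_ * _)%E; apply/esym; exact: (completed_measureE mA mB mN N0 BA ABN).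
Qed.

Lemma measurable_split_Rn : measurable_fun setT split_Rn.
Proof.
apply/measurable_fun_pairP; split => /= _ Y mY; rewrite setTI.
  have [+ _] := lebesgue_rectangle mY (@measurableT _ (measurableTypeR R)).
  by rewrite setXT.
have [+ _] := lebesgue_rectangle (@measurableT _ (Rn R n)) mY.
by rewrite setTX.
Qed.

HB.instance Definition _ :=
  isMeasurableFun.Build _ _ _ _ split_Rn measurable_split_Rn.

Local Open Scope ereal_scope.

(** Both sides agree on rectangles, and a sigma-finite measure on a product is
    determined by the rectangles. *)
Lemma lebesgue_pushforward (X : set (Rn R n * measurableTypeR R)) :
  measurable X ->
  (sf_lebesgue R n \x lebesgue_measure) X =
    pushforward (lebesgue R n.+1) split_Rn X.
Proof.
move=> mX.
apply: (@product_measure_unique _ _ _ _ _ (sf_lebesgue R n)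
  (@lebesgue_measure R) (pushforward (lebesgue R n.+1) split_Rn)) => //.
by move=> A I mA mI; exact: (lebesgue_rectangle mA mI).2.
Qed.

Lemma integral_split_Rn (D : set (Rn R n * measurableTypeR R))
    (h : Rn R n * measurableTypeR R -> \bar R) :
  measurable D -> measurable_fun D h -> (forall z, D z -> 0 <= h z) ->
  \int[lebesgue R n.+1]_(x in split_Rn @^-1` D) h (split_Rn x) =
  \int[sf_lebesgue R n \x lebesgue_measure]_(z in D) h z.
Proof.
move=> mD mh h0.
transitivity (\int[pushforward (lebesgue R n.+1) split_Rn]_(z in D) h z).
  apply/esym; apply: (ge0_integral_pushforward measurable_split_Rn) => //.
  by move=> z; rewrite inE => /h0.
apply: eq_measure_integral => X mX _.
exact/esym/lebesgue_pushforward.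
Qed.

End Rn_facts.

(** * Integration of nonnegative functions *)
Section tonelli_on.
Local Open Scope ereal_scope.
Context d1 d2 (T1 : measurableType d1) (T2 : measurableType d2) (R : realType).
Variable m1 : {sigma_finite_measure set T1 -> \bar R}.
Variable m2 : {sigma_finite_measure set T2 -> \bar R}.
Variables (A : set T1) (B : set T2).
Hypotheses (mA : measurable A) (mB : measurable B).
Variable f : T1 * T2 -> \bar R.
Hypothesis mf : measurable_fun (A `*` B) f.
Hypothesis f0 : forall z, 0 <= f z.

Let g := f \_ (A `*` B).
Let mg : measurable_fun setT g.
Proof. exact: (measurable_restrictT _ (measurableX mA mB)).1. Qed.
Let g0 z : 0 <= g z.
Proof. by rewrite /g patchE; case: ifP. Qed.

Let gF : fubini_F m2 g = (fun x => \int[m2]_(y in B) f (x, y)) \_ A.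
Proof.
apply/funext => x; rewrite /fubini_F /g patchE; case: ifPn => xA.
  rewrite [RHS]integral_mkcond; apply: eq_integral => y _.
  by rewrite !patchE in_setX xA.
rewrite integral0_eq// => y _; rewrite patchE in_setX (negbTE xA)//.
Qed.

Let gG : fubini_G m1 g = (fun y => \int[m1]_(x in A) f (x, y)) \_ B.
Proof.
apply/funext => y; rewrite /fubini_G /g patchE; case: ifPn => yB.
  rewrite [RHS]integral_mkcond; apply: eq_integral => x _.
  by rewrite !patchE in_setX yB andbT.
by rewrite integral0_eq// => x _; rewrite patchE in_setX (negbTE yB) andbF.
Qed.

Lemma tonelli_on_measurable :
  measurable_fun A (fun x => \int[m2]_(y in B) f (x, y)).
Proof.
by apply/(measurable_restrictT _ mA); rewrite -gF; exact: measurable_fun_fubini_tonelli_F.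
Qed.

Lemma tonelli_on1 :
  \int[m1 \x m2]_(z in A `*` B) f z = \int[m1]_(x in A) \int[m2]_(y in B) f (x, y).
Proof.
rewrite integral_mkcond [RHS]integral_mkcond -gF.
exact: (@fubini_tonelli1 _ _ _ _ _ m1 m2 g mg g0).
Qed.

Lemma tonelli_on :
  \int[m1]_(x in A) \int[m2]_(y in B) f (x, y) =
  \int[m2]_(y in B) \int[m1]_(x in A) f (x, y).
Proof.
rewrite integral_mkcond [RHS]integral_mkcond -gF -gG.
exact: (@fubini_tonelli _ _ _ _ _ m1 m2 g mg g0).
Qed.

End tonelli_on.

Section integral_extra.
Local Open Scope ereal_scope.
Context d (T : measurableType d) (R : realType).
Variable mu : {measure set T -> \bar R}.

Import HBNNSimple.

(** The integral of a nonnegative function is a supremum over the simple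
    functions below it, so that it is monotone without any measurability. *)
Lemma ge0_le_integral_nomeas (D : set T) (f g : T -> \bar R) :
  (forall x, D x -> 0 <= f x) -> (forall x, D x -> f x <= g x) ->
  \int[mu]_(x in D) f x <= \int[mu]_(x in D) g x.
Proof.
move=> f0 fg; have g0 x : D x -> 0 <= g x.
  by move=> Dx; apply: le_trans (fg _ Dx); exact: f0.
rewrite !ge0_integralE//; apply: le_ereal_sup => _ [h hf <-].
exists h => // x; apply: le_trans (hf x) _; rewrite !patchE.
by case: ifPn => // /set_mem; exact: fg.
Qed.

Lemma ge0_integral_setU_le (A B : set T) (f : T -> \bar R) :
  measurable A -> measurable B -> measurable_fun (A `|` B) f ->
  (forall x, 0 <= f x) ->
  \int[mu]_(x in A `|` B) f x <=
    \int[mu]_(x in A) f x + \int[mu]_(x in B) f x.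
Proof.
move=> mA mB mf f0.
have AE : A `|` B = A `|` (B `\` A).
  apply/seteqP; split => x [Ax|Bx]; [by left| |by left|by right; case: Bx].
  by have [Ax|nAx] := pselect (A x); [left|right].
rewrite AE ge0_integral_setU//.
- rewrite leeD2l//; apply: ge0_subset_integral => //.
  + exact: measurableD.
  + by apply: measurable_funS mf => //; exact: measurableU.
- exact: measurableD.
- by rewrite -AE.
- apply/disj_setPS => x [Ax []] //.
Qed.

End integral_extra.

(** * Integrals of powers on intervals *)
Section one_dim.
Context {R : realType}.
Implicit Types (a b c d e g r s t u L l : R).
Local Notation mu := (@lebesgue_measure R).

(** The sign [e] covers the intervals on either side of the singularity
    [t]. *)
Lemma powR_FTC g t c d e : e * e = 1 -> c < d -> g != 1 ->
  {in `[c, d], forall u, 0 < e * (u - t)} ->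
  (\int[mu]_(u in `[c, d]) (((e * (u - t)) `^ g)^-1)%:E)%E =
  (e * ((e * (d - t)) `^ (1 - g) - (e * (c - t)) `^ (1 - g)) / (1 - g))%:E.
Proof.
move=> ee cd g1 pos.
have g10 : 1 - g != 0 by rewrite subr_eq0 eq_sym.
pose F u := e / (1 - g) * (e * (u - t)) `^ (1 - g).
have dF u : 0 < e * (u - t) -> is_derive u 1 F (((e * (u - t)) `^ g)^-1).
  move=> u0; rewrite /F.
  have dlin : is_derive u 1 (fun v => e * (v - t)) e.
    by apply: is_derive_eq; rewrite /GRing.scale /=; ring.
  have dpow := is_derive1_powR (1 - g) u0.
  have := @is_derive1_comp R (@powR R ^~ (1 - g)) _ u _ _ dpow dlin.
  move=> dcomp.
  apply: is_derive_eq; rewrite /GRing.scale /=.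
  rewrite -powRN (_ : 1 - g - 1 = - g); last by ring.
  rewrite (_ : e / (1 - g) * _ = (e * e) * ((1 - g) / (1 - g)) * (e * (u - t)) `^ (- g)).
    by rewrite ee divff// !mul1r.
  by field.
have cF u : u \in `[c, d] -> {for u, continuous F}.
  move=> /pos /dF [+ _] => /derivable1_diffP.
  exact: differentiable_continuous.
have cc : c \in `[c, d] by rewrite in_itv /= lexx ltW.
have dd : d \in `[c, d] by rewrite in_itv /= lexx ltW.
rewrite (@continuous_FTC2 _ _ F)//.
- rewrite -EFinB /F; congr (_%:E); field; lra.
- apply: derivable_within_continuous => u ucd.
  have u0 := pos u ucd.
  have dlin : is_derive u 1 (fun v => e * (v - t)) e.
    by apply: is_derive_eq; rewrite /GRing.scale /=; ring.
  have dpow := is_derive1_powR (- g) u0.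
  rewrite (_ : (fun _ => _) = (@powR R ^~ (- g)) \o (fun v => e * (v - t))).
    by have [] := @is_derive1_comp R (@powR R ^~ (- g)) _ u _ _ dpow dlin.
  by apply/funext => v /=; rewrite powRN.
- split.
  + move=> u ucd; have [] // : is_derive u 1 F (((e * (u - t)) `^ g)^-1).
    by apply/dF/pos; apply: subset_itv_oo_cc ucd.
  + apply: cvg_at_right_filter; exact: cF.
  + apply: cvg_at_left_filter; exact: cF.
- move=> u ucd; rewrite derive1E; have [_ ->//] : is_derive u 1 F (((e * (u - t)) `^ g)^-1).
  by apply/dF/pos; apply: subset_itv_oo_cc ucd.
Qed.

(** The value at 0 is 0 or 1, as in the kernel of the energy. *)
Definition riesz (b r : R) : R := (r `^ b)^-1.

Lemma riesz_ge0 b r : 0 <= riesz b r.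
Proof. by rewrite invr_ge0 powR_ge0. Qed.

Lemma riesz_gt0 b r : 0 < r -> 0 < riesz b r.
Proof. by move=> r0; rewrite invr_gt0 powR_gt0. Qed.

Lemma riesz_powR b r : riesz b r = r `^ (- b).
Proof. by rewrite powRN. Qed.

Lemma riesz_le b r s : 0 <= b -> 0 < r -> r <= s -> riesz b s <= riesz b r.
Proof.
move=> b0 r0 rs; rewrite lef_pV2 ?posrE ?powR_gt0//; last exact: lt_le_trans rs.
by rewrite ge0_ler_powR// nnegrE ltW// (lt_le_trans r0).
Qed.

Lemma measurable_riesz b : measurable_fun setT (riesz b).
Proof.
rewrite (_ : riesz b = @powR R ^~ (- b)); first exact: measurable_powR.
by apply/funext => r; rewrite riesz_powR.
Qed.

Definition hypot (r u : R) : R := Num.sqrt (r ^+ 2 + u ^+ 2).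

Lemma hypot_gel r u : 0 <= r -> r <= hypot r u.
Proof.
move=> r0; rewrite -{1}(ger0_norm r0) -sqrtr_sqr; apply: ler_wsqrtr.
by rewrite lerDl sqr_ge0.
Qed.

Lemma hypot_ger r u : `|u| <= hypot r u.
Proof.
by rewrite -sqrtr_sqr; apply: ler_wsqrtr; rewrite lerDr sqr_ge0.
Qed.

Lemma hypot_le r u L : 0 <= r -> `|u| <= L -> r <= L -> hypot r u <= 2 * L.
Proof.
move=> r0 uL rL; have L0 : 0 <= L by exact: le_trans rL.
have -> : 2 * L = Num.sqrt ((2 * L) ^+ 2).
  by rewrite sqrtr_sqr ger0_norm// mulr_ge0.
apply: ler_wsqrtr; move: uL; rewrite ler_norml => /andP[u1 u2]; nra.
Qed.

Lemma measurable_hypot dT (T : measurableType dT) (f g : T -> R) :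
  measurable_fun setT f -> measurable_fun setT g ->
  measurable_fun setT (fun z => hypot (f z) (g z)).
Proof.
move=> mf mg; apply: (measurableT_comp (f := @Num.sqrt R)).
  by apply: continuous_measurable_fun; exact: sqrt_continuous.
by apply: measurable_funD; exact: measurable_funX.
Qed.

Lemma measurable_riesz_hypot b r t (I : set R) :
  measurable_fun I (fun u => (riesz b (hypot r (t - u)))%:E).
Proof.
apply/measurable_EFinP; apply: measurable_funTS.
apply: (measurableT_comp (measurable_riesz b)).
apply: (@measurable_hypot _ _ (fun=> r) (fun u => t - u)) => //.
exact: measurable_funB.
Qed.

Lemma itv_length (t h : R) (b0 b1 : bool) : 0 < h ->
  mu [set` Interval (BSide b0 t) (BSide b1 (t + h))] = h%:E.
Proof.
move=> h0; rewrite lebesgue_measure_itv/= lte_fin ltrDl h0.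
by rewrite -EFinB addrAC subrr add0r.
Qed.

(** The sides of a cube: any of the four types of bounded intervals. *)
Definition side (b0 b1 : bool) (a l : R) : set R :=
  [set` Interval (BSide b0 a) (BSide b1 (a + l))].

Lemma measurable_side (b0 b1 : bool) a l : measurable (side b0 b1 a l).
Proof. exact: measurable_itv. Qed.

Lemma side_bounds (b0 b1 : bool) a l t : side b0 b1 a l t -> a <= t <= a + l.
Proof. by rewrite /side/= in_itv/= => /andP[/lteifW-> /lteifW->]. Qed.

Lemma in_side (b0 b1 : bool) a l t : a < t < a + l -> side b0 b1 a l t.
Proof.
move=> /andP[t1 t2]; rewrite /side/= in_itv/=; apply/andP.
by split; [case: b0|case: b1] => //=; exact: ltW.
Qed.

(** A lower bound for the ratio of two values of [riesz b] at points within a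
    factor 2, whatever the sign of [b]. *)
Definition doubling_const b : R := Num.min 1 (riesz b 2).

Lemma doubling_const_gt0 b : 0 < doubling_const b.
Proof. by rewrite lt_min ltr01 riesz_gt0. Qed.

Lemma riesz_double b r s : 0 < r -> r <= s -> s <= 2 * r ->
  doubling_const b * riesz b r <= riesz b s.
Proof.
move=> r0 rs s2; have s0 : 0 < s by exact: lt_le_trans rs.
have [b0|b0] := leP 0 b.
- apply: (@le_trans _ _ (riesz b 2 * riesz b r)).
    by rewrite ler_wpM2r ?riesz_ge0// ge_min lexx orbT.
  have -> : riesz b 2 * riesz b r = riesz b (2 * r).
    by rewrite /riesz powRM ?invfM// ltW.
  exact: riesz_le.
- apply: (@le_trans _ _ (riesz b r)).
    by rewrite ler_piMl ?riesz_ge0// ge_min lexx.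
  rewrite !riesz_powR; apply: ge0_ler_powR => //; last 2 first.
  - by rewrite nnegrE ltW.
  - by rewrite nnegrE ltW.
  - by rewrite oppr_ge0 ltW.
Qed.

Lemma mul_riesz s r : 0 < r -> r * riesz (s + 1) r = riesz s r.
Proof.
move=> r0; rewrite !riesz_powR -{1}(powRr1 (ltW r0)) -powRD.
  by congr powR; ring.
by rewrite (gt_eqF r0) implybT.
Qed.

Local Open Scope ereal_scope.

(** One of the two intervals of length [h = r / (2 D + 1)] next to [t] lies in
    the interval of integration, because [h] is at most [l / 2]; on it the
    hypotenuse is between [r] and [2 r], as [h <= r].  This holds for every
    real [s]. *)
Lemma riesz_fiber_ge s D : (0 < D)%R -> exists2 c, (0 < c)%R &
  forall l r t a (b0 b1 : bool), (0 < r)%R -> (r <= D * l)%R -> (a <= t <= a + l)%R ->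
  (c * riesz s r)%:E <=
    \int[mu]_(u in side b0 b1 a l)
      (riesz (s + 1) (hypot r (t - u)))%:E.
Proof.
move=> D0; pose k := ((2 * D + 1)^-1)%R.
have k0 : (0 < k)%R by rewrite invr_gt0; lra.
exists (doubling_const (s + 1) * k)%R; first by rewrite mulr_gt0// doubling_const_gt0.
move=> l r t a b0 b1 r0 rD tI.
pose h := (k * r)%R.
have kE : (k * (2 * D + 1) = 1)%R by rewrite mulVf//; lra.
have h0 : (0 < h)%R by rewrite mulr_gt0.
have hr : (h <= r)%R by rewrite /h; nra.
have hl : (2 * h <= l)%R by rewrite /h; nra.
have key v : (t - h <= v)%R -> (v <= t)%R -> (a <= v)%R -> (v + h <= a + l)%R ->
  (doubling_const (s + 1) * k * riesz s r)%:E <=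
    \int[mu]_(u in side b0 b1 a l)
      (riesz (s + 1) (hypot r (t - u)))%:E.
  move=> v1 v2 av vl.
  apply: (@le_trans _ _ (\int[mu]_(u in `]v, (v + h)%R[)
      (riesz (s + 1) (hypot r (t - u)))%:E)); last first.
    apply: ge0_subset_integral => //.
    - exact: measurable_side.
    - exact: measurable_riesz_hypot.
    - by move=> u _; rewrite lee_fin riesz_ge0.
    - move=> u /=; rewrite in_itv/= => /andP[u1 u2].
      by apply: in_side; rewrite (le_lt_trans av u1) (lt_le_trans u2 vl).
  apply: (@le_trans _ _ (\int[mu]_(u in `]v, (v + h)%R[)
      (cst (doubling_const (s + 1) * riesz (s + 1) r)%:E u))).
    rewrite integral_cst//= itv_length// -EFinM lee_fin.
    rewrite -(mul_riesz s r0) /h.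
    by rewrite le_eqVlt; apply/orP; left; apply/eqP; ring.
  apply: ge0_le_integral_nomeas => [u _|u /=].
    by rewrite lee_fin mulr_ge0 ?riesz_ge0 ?ltW ?doubling_const_gt0.
  rewrite in_itv/= => /andP[u1 u2]; rewrite lee_fin riesz_double//.
    by rewrite hypot_gel ?ltW.
  apply: hypot_le => //; first exact: ltW.
  by rewrite ler_norml; apply/andP; split; lra.
move/andP : tI => [at_ tl].
have [th|th] := leP (t + h)%R (a + l)%R; first by apply: (key t) => //; lra.
by apply: (key (t - h)%R) => //; lra.
Qed.

(** On [|t - u| <= r] the integrand is at most [r ^ - (s + 1)]; outside it is
    at most [|t - u| ^ - (s + 1)], which is integrable at infinity as
    [s > 0]. *)
Lemma riesz_fiber_le s r t L (I : set R) : (0 < s)%R -> (0 < r)%R ->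
  measurable I -> I `<=` `[(t - L)%R, (t + L)%R] ->
  \int[mu]_(u in I) (riesz (s + 1) (hypot r (t - u)))%:E <=
    ((2 + 2 / s) * riesz s r)%:E.
Proof.
move=> s0 r0 mI IL; pose M := (r + 1 + `|L|)%R.
have rM : (r < M)%R by rewrite /M; have := normr_ge0 L; lra.
have LM : (L <= M)%R by rewrite /M; have := ler_norm L; lra.
pose f u : \bar R := (riesz (s + 1) (hypot r (t - u)))%:E.
have mf J : measurable_fun J f by exact: measurable_riesz_hypot.
have f0 u : 0 <= f u by rewrite lee_fin riesz_ge0.
apply: (@le_trans _ _ (\int[mu]_(u in `[(t - r)%R, (t + r)%R] `|`
  (`[(t - M)%R, (t - r)%R] `|` `[(t + r)%R, (t + M)%R])) f u)).
  have mU : measurable (`[(t - r)%R, (t + r)%R] `|`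
      (`[(t - M)%R, (t - r)%R] `|` `[(t + r)%R, (t + M)%R])).
    by apply: measurableU => //; exact: measurableU.
  apply: (ge0_subset_integral mu mI mU (mf _)) => // u Iu.
  have := IL u Iu; rewrite /= !in_itv/= => /andP[u1 u2].
  have [u3|u3] := leP u (t - r)%R; first by right; left; apply/andP; split; lra.
  have [u4|u4] := leP (t + r)%R u; first by right; right; apply/andP; split; lra.
  by left; apply/andP; split; lra.
have sE : (1 - (s + 1) = - s)%R by ring.
have s1 : (s + 1 != 1)%R by rewrite -subr_eq0 addrK gt_eqF.
have mJ (x y : R) : measurable (`[x, y]%classic : set R) by [].
apply: (le_trans (ge0_integral_setU_le mu (mJ _ _)
  (measurableU _ _ (mJ _ _) (mJ _ _)) (mf _) f0)).
rewrite mulrDl EFinD; apply: leeD.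
- apply: (@le_trans _ _ (\int[mu]_(u in `[(t - r)%R, (t + r)%R])
      (cst (riesz (s + 1) r)%:E u))).
    apply: ge0_le_integral_nomeas => // u _.
    by rewrite lee_fin riesz_le ?hypot_gel ?ltW// addr_gt0.
  rewrite integral_cst//= (_ : (t + r = t - r + 2 * r)%R); last by ring.
  rewrite itv_length ?mulr_gt0// -EFinM lee_fin -(mul_riesz s r0).
  by rewrite le_eqVlt; apply/orP; left; apply/eqP; ring.
- have -> : ((2 / s * riesz s r) = riesz s r / s + riesz s r / s)%R.
    by field; rewrite gt_eqF.
  apply: (le_trans (ge0_integral_setU_le mu (mJ _ _) (mJ _ _) (mf _) f0)).
  have rs : (riesz s r / s - riesz s M / s <= riesz s r / s)%R.
    by rewrite lerBlDr lerDl divr_ge0 ?riesz_ge0// ltW.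
  rewrite EFinD; apply: leeD.
  + apply: (@le_trans _ _ (\int[mu]_(u in `[(t - M)%R, (t - r)%R])
        (((-1 * (u - t)) `^ (s + 1))^-1)%:E)).
      apply: ge0_le_integral_nomeas => // u /=; rewrite in_itv/= => /andP[u1 u2].
      rewrite lee_fin [leRHS](_ : _ = riesz (s + 1) (-1 * (u - t))) //.
      apply: riesz_le; [by lra|by lra|].
      apply: le_trans (hypot_ger _ _); apply: le_trans (ler_norm _); lra.
    rewrite powR_FTC//; last 3 first.
      by ring.
      by lra.
      by move=> u; rewrite in_itv/= => /andP[u1 u2]; lra.
    rewrite sE lee_fin; apply: le_trans rs; rewrite !riesz_powR.
    rewrite (_ : (-1 * (t - r - t) = r)%R); last by ring.
    rewrite (_ : (-1 * (t - M - t) = M)%R); last by ring.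
    by rewrite le_eqVlt; apply/orP; left; apply/eqP; field; rewrite gt_eqF.
  + apply: (@le_trans _ _ (\int[mu]_(u in `[(t + r)%R, (t + M)%R])
        (((1 * (u - t)) `^ (s + 1))^-1)%:E)).
      apply: ge0_le_integral_nomeas => // u /=; rewrite in_itv/= => /andP[u1 u2].
      rewrite lee_fin [leRHS](_ : _ = riesz (s + 1) (1 * (u - t))) //.
      apply: riesz_le; [by lra|by lra|].
      apply: le_trans (hypot_ger _ _); rewrite distrC.
      apply: le_trans (ler_norm _); lra.
    rewrite powR_FTC//; last 3 first.
      by ring.
      by lra.
      by move=> u; rewrite in_itv/= => /andP[u1 u2]; lra.
    rewrite sE lee_fin; apply: le_trans rs; rewrite !riesz_powR.
    rewrite (_ : (1 * (t + r - t) = r)%R); last by ring.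
    rewrite (_ : (1 * (t + M - t) = M)%R); last by ring.
    by rewrite le_eqVlt; apply/orP; left; apply/eqP; field; rewrite gt_eqF.
Qed.

End one_dim.

Section half.
Context {R : realType}.
Local Notation mu := (@lebesgue_measure R).
Local Open Scope ereal_scope.

Lemma measurable_riesz_dist (b t : R) (I : set R) :
  measurable_fun I (fun u => (riesz b `|t - u|)%:E).
Proof.
apply/measurable_EFinP; apply: measurable_funTS.
apply: (measurableT_comp (measurable_riesz b)).
by apply: measurableT_comp => //; exact: measurable_funB.
Qed.

Lemma riesz_half_annulus (t x L : R) : (0 < x < L)%R ->
  \int[mu]_(u in `[(t - L)%R, (t - x)%R] `|` `[(t + x)%R, (t + L)%R])
    (riesz 2^-1 `|t - u|)%:E <= (4 * L `^ 2^-1)%:E.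
Proof.
move=> /andP[x0 xL].
have mJ (a b : R) : measurable (`[a, b]%classic : set R) by [].
pose f u : \bar R := (riesz 2^-1 `|t - u|)%:E.
have mf J : measurable_fun J f by exact: measurable_riesz_dist.
have f0 u : 0 <= f u by rewrite lee_fin riesz_ge0.
apply: (le_trans (ge0_integral_setU_le mu (mJ _ _) (mJ _ _) (mf _) f0)).
rewrite /f {mf f0}.
have g1 : (2^-1 != 1 :> R)%R by rewrite lt_eqF// invf_lt1// ltr1n.
have h12 : (1 - 2^-1 = 2^-1 :> R)%R by field.
have px := powR_ge0 x 2^-1.
have -> : (4 * L `^ 2^-1 = 2 * L `^ 2^-1 + 2 * L `^ 2^-1)%R by ring.
rewrite EFinD; apply: leeD.
- have -> : \int[mu]_(u in `[(t - L)%R, (t - x)%R]) (riesz 2^-1 `|t - u|)%:E =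
      \int[mu]_(u in `[(t - L)%R, (t - x)%R]) (((-1 * (u - t)) `^ 2^-1)^-1)%:E.
    apply: eq_integral => u; rewrite inE/= in_itv/= => /andP[u1 u2].
    by rewrite /riesz ger0_norm ?subr_ge0 1?mulN1r ?opprB//; lra.
  rewrite powR_FTC//; last 3 first.
  + by ring.
  + by lra.
  + by move=> u; rewrite in_itv/= => /andP[u1 u2]; lra.
  rewrite lee_fin h12 invrK.
  rewrite (_ : (-1 * (t - x - t) = x)%R); last by ring.
  by rewrite (_ : (-1 * (t - L - t) = L)%R); [lra|ring].
- have -> : \int[mu]_(u in `[(t + x)%R, (t + L)%R]) (riesz 2^-1 `|t - u|)%:E =
      \int[mu]_(u in `[(t + x)%R, (t + L)%R]) (((1 * (u - t)) `^ 2^-1)^-1)%:E.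
    apply: eq_integral => u; rewrite inE/= in_itv/= => /andP[u1 u2].
    by rewrite /riesz distrC ger0_norm ?subr_ge0 1?mul1r//; lra.
  rewrite powR_FTC//; last 3 first.
  + by ring.
  + by lra.
  + by move=> u; rewrite in_itv/= => /andP[u1 u2]; lra.
  rewrite lee_fin h12 invrK.
  rewrite (_ : (1 * (t + x - t) = x)%R); last by ring.
  by rewrite (_ : (1 * (t + L - t) = L)%R); [lra|ring].
Qed.

(** Monotone convergence over the annuli [L / (k + 2) <= |t - u| <= L]. *)
Lemma riesz_half (t L : R) (I : set R) : (0 < L)%R ->
  measurable I -> I `<=` `[(t - L)%R, (t + L)%R] ->
  \int[mu]_(u in I) (riesz 2^-1 `|t - u|)%:E <= (4 * L `^ 2^-1)%:E.
Proof.
move=> L0 mI IL.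
pose f u : \bar R := (riesz 2^-1 `|t - u|)%:E.
have mf J : measurable_fun J f by exact: measurable_riesz_dist.
have f0 u : 0 <= f u by rewrite lee_fin riesz_ge0.
pose x (k : nat) : R := (L / k.+2%:R)%R.
have x0 k : (0 < x k < L)%R.
  by rewrite divr_gt0//= ltr_pdivrMr// ltr_pMr// ltr1n.
pose F k : set R := `[(t - L)%R, (t - x k)%R] `|` `[(t + x k)%R, (t + L)%R].
have mF k : measurable (F k) by apply: measurableU.
have ndF : nondecreasing_seq F.
  move=> i j ij; apply/subsetPset.
  have xij : (x j <= x i)%R by rewrite ler_pM2l// lef_pV2 ?posrE// ler_nat !ltnS.
  move=> u [] /=; rewrite in_itv/= => /andP[u1 u2]; [left|right];
    rewrite /= in_itv/=; apply/andP; split; lra.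
have mUF : measurable (\bigcup_k F k) by exact: bigcupT_measurable.
have UF : I `<=` (\bigcup_k F k) `|` [set t].
  move=> u Iu; have := IL u Iu; rewrite /= in_itv/= => /andP[u1 u2].
  have [->|ut] := eqVneq u t; [by right|left].
  have d0 : (0 < `|u - t|)%R by rewrite normr_gt0 subr_eq0.
  pose k := Num.truncn (L / `|u - t|)%R.
  have kk : (L / `|u - t| < k.+1%:R)%R by rewrite truncnS_gt.
  have xk : (x k < `|u - t|)%R.
    rewrite /x ltr_pdivrMr// mulrC -ltr_pdivrMr//; apply: lt_le_trans kk _.
    by rewrite ler_nat.
  exists k => //; rewrite /F /= !in_itv/=.
  have [ut'|/ltW ut'] := leP u t; [left|right].
  - move: xk; rewrite ler0_norm ?subr_le0// => xk.
    by apply/andP; split; lra.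
  - move: xk; rewrite ger0_norm ?subr_ge0// => xk.
    by apply/andP; split; lra.
have limF : \int[mu]_(u in \bigcup_k F k) f u <= (4 * L `^ 2^-1)%:E.
  have cF := @ge0_nondecreasing_set_cvg_integral _ (measurableTypeR R) R F f mu ndF mF
    (fun i => mf _) (fun i u _ => f0 u).
  rewrite -(cvg_lim _ cF)//; apply: lime_le; first by apply/cvg_ex; eexists; exact: cF.
  by apply: nearW => k; exact: riesz_half_annulus.
have mt : measurable ([set t] : set R) by [].
apply: (le_trans (ge0_subset_integral mu mI (measurableU _ _ mUF mt) (mf _)
  (fun u _ => f0 u) UF)).
apply: (le_trans (ge0_integral_setU_le mu mUF mt (mf _) f0)).
by rewrite integral_set1 adde0.
Qed.

(** The point [u = t] has to be removed before comparing, since the value of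
    [riesz] at 0 is not the infinite limit. *)
Lemma riesz_half_hypot (r t L : R) (I : set R) : (0 <= r)%R -> (0 < L)%R ->
  measurable I -> I `<=` `[(t - L)%R, (t + L)%R] ->
  \int[mu]_(u in I) (riesz 2^-1 (hypot r (t - u)))%:E <= (4 * L `^ 2^-1)%:E.
Proof.
move=> r0 L0 mI IL.
have mf (J : set R) : measurable_fun J (fun u => (riesz 2^-1 (hypot r (t - u)))%:E).
  exact: measurable_riesz_hypot.
have mIt : measurable (I `\ t) by exact: measurableD.
rewrite -(integral_setD1 mIt (mf _)).
apply: le_trans (riesz_half L0 mIt _); last by move=> u [Iu _]; exact: IL.
apply: ge0_le_integral_nomeas => [u _|u [Iu ut]]; first by rewrite lee_fin riesz_ge0.
rewrite lee_fin; apply: riesz_le; first by rewrite invr_ge0.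
  by rewrite normr_gt0 subr_eq0 eq_sym; apply/eqP.
exact: hypot_ger.
Qed.

End half.

(** * Comparison of energies on a set and on the cylinder above it *)
Section cylinder_integral.
Context dT (T : measurableType dT) (R : realType).
Variable m : {sigma_finite_measure set T -> \bar R}.
Local Notation mu := (@lebesgue_measure R).
Local Open Scope ereal_scope.
Variables (Q : set T) (I : set R) (k : T * T -> R) (G : T -> T -> R -> \bar R).
Hypotheses (mQ : measurable Q) (mI : measurable I).
Hypotheses (mk : measurable_fun setT k) (k0 : forall z, (0 <= k z)%R).

Let mkE : measurable_fun (Q `*` Q) (EFin \o k).
Proof. by apply/measurable_EFinP; exact: measurable_funTS. Qed.

Let kE0 z : 0 <= (EFin \o k) z.
Proof. by rewrite lee_fin. Qed.

Let mkx x : measurable_fun Q (fun y => (k (x, y))%:E).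
Proof.
apply/measurable_EFinP; apply: measurable_funTS.
exact: (measurableT_comp mk (measurable_pair1 x)).
Qed.

Let H x := \int[m]_(y in Q) (k (x, y))%:E.

Let mH : measurable_fun Q H.
Proof. exact: (tonelli_on_measurable m mQ mQ mkE kE0). Qed.

Let H0 x : 0 <= H x.
Proof. by apply: integral_ge0 => y _; rewrite lee_fin. Qed.

Let cylE C : (0 <= C)%R ->
  \int[m]_(x in Q) \int[mu]_(t in I) \int[m]_(y in Q) (C * k (x, y))%:E =
  C%:E * mu I * \int[m]_(x in Q) \int[m]_(y in Q) (k (x, y))%:E.
Proof.
move=> C0.
transitivity (\int[m]_(x in Q) (C%:E * mu I * H x)).
  apply: eq_integral => x _.
  transitivity (\int[mu]_(t in I) (cst (C%:E * H x) t)).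
    apply: eq_integral => t _ /=.
    by rewrite -ge0_integralZl// => y _; rewrite lee_fin.
  by rewrite integral_cst// muleAC.
by rewrite ge0_integralZl// mule_ge0.
Qed.

Lemma cyl_le C : (0 <= C)%R ->
  (forall x y t, Q x -> Q y -> I t -> 0 <= G x y t) ->
  (forall x y t, Q x -> Q y -> I t -> G x y t <= (C * k (x, y))%:E) ->
  \int[m]_(x in Q) \int[mu]_(t in I) \int[m]_(y in Q) G x y t <=
  C%:E * mu I * \int[m]_(x in Q) \int[m]_(y in Q) (k (x, y))%:E.
Proof.
move=> C0 G0 GC; rewrite -(cylE C0).
apply: ge0_le_integral_nomeas => x Qx.
  apply: integral_ge0 => t It; apply: integral_ge0 => y Qy; exact: G0.
apply: ge0_le_integral_nomeas => t It.
  apply: integral_ge0 => y Qy; exact: G0.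
by apply: ge0_le_integral_nomeas => y Qy; [exact: G0|exact: GC].
Qed.

Lemma cyl_ge C : (0 <= C)%R ->
  (forall x y t, Q x -> Q y -> I t -> (C * k (x, y))%:E <= G x y t) ->
  C%:E * mu I * \int[m]_(x in Q) \int[m]_(y in Q) (k (x, y))%:E <=
  \int[m]_(x in Q) \int[mu]_(t in I) \int[m]_(y in Q) G x y t.
Proof.
move=> C0 GC; rewrite -(cylE C0).
have Ck0 z : 0 <= (C * k z)%:E by rewrite lee_fin mulr_ge0.
apply: ge0_le_integral_nomeas => x Qx.
  by apply: integral_ge0 => t It; apply: integral_ge0.
apply: ge0_le_integral_nomeas => t It; first by apply: integral_ge0.
by apply: ge0_le_integral_nomeas => y Qy //; exact: GC.
Qed.

End cylinder_integral.

Section triple.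
Context dT (T : measurableType dT) (R : realType).
Variable m : {sigma_finite_measure set T -> \bar R}.
Local Open Scope ereal_scope.
Variables (Q : set T) (K w : T * T -> R) (far : set (T * T)).
Hypotheses (mQ : measurable Q) (mfar : measurable far).
Hypotheses (mK : measurable_fun setT K) (K0 : forall z, (0 <= K z)%R).
Hypotheses (mw : measurable_fun setT w) (w0 : forall z, (0 <= w z)%R).
Hypothesis wC : forall x y, w (x, y) = w (y, x).

(** Averaging over the points [z] that are far from both [x] and [y] gives
    [m Q * K (x, y) <= 2 C (H x + H y)], where [H x] is the integral of
    [K (x, z)] over the [z] far from [x]; it remains to integrate against [w],
    whose partial integrals are at most [W]. *)
Lemma triple_integral (C W : R) : (0 <= C)%R -> (0 <= W)%R ->
  (forall x y z, Q x -> Q y -> Q z ->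
    (K (x, y) <= C * (K (x, z) + K (y, z)))%R) ->
  (forall x y, Q x -> Q y ->
    m Q <= 2%:E * m (Q `&` [set z | far (x, z) /\ far (y, z)])) ->
  (forall x, Q x -> \int[m]_(y in Q) (w (x, y))%:E <= W%:E) ->
  m Q * \int[m]_(x in Q) \int[m]_(y in Q) (K (x, y) * w (x, y))%:E <=
  (4 * C * W)%:E *
    \int[m]_(x in Q) \int[m]_(y in Q) (K (x, y) * \1_far (x, y))%:E.
Proof.
move=> C0 W0 KC Hfar HW.
pose h z : \bar R := (K z * \1_far z)%:E.
have h0 z : 0 <= h z by rewrite lee_fin mulr_ge0.
have mh : measurable_fun setT h.
  by apply/measurable_EFinP; apply: measurable_funM.
have mhx x : measurable_fun Q (fun y => h (x, y)).
  by apply: measurable_funTS; exact: (measurableT_comp mh (measurable_pair1 x)).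
pose H x := \int[m]_(y in Q) h (x, y).
have mH : measurable_fun Q H.
  by apply: (tonelli_on_measurable m mQ mQ (f := h)); [exact: measurable_funTS|].
have H0 x : 0 <= H x by apply: integral_ge0.
have mwE : measurable_fun setT (EFin \o w) by apply/measurable_EFinP.
have mwx x : measurable_fun Q (fun y => (w (x, y))%:E).
  by apply: measurable_funTS; exact: (measurableT_comp mwE (measurable_pair1 x)).
have mKw : measurable_fun setT (fun z => (K z * w z)%:E).
  by apply/measurable_EFinP; exact: measurable_funM.
have mKwx x : measurable_fun Q (fun y => (K (x, y) * w (x, y))%:E).
  by apply: measurable_funTS; exact: (measurableT_comp mKw (measurable_pair1 x)).
have Kw0 z : 0 <= (K z * w z)%:E by rewrite lee_fin mulr_ge0.
(* The average over the far points z, which are at least half of Q. *)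
have avg x y : Q x -> Q y -> m Q * (K (x, y))%:E <= (2 * C)%:E * (H x + H y).
  move=> Qx Qy.
  pose S := Q `&` [set z | far (x, z) /\ far (y, z)].
  have mS : measurable S.
    apply: measurableI => //; apply: measurableI.
      by have := measurable_pair1 x measurableT mfar; rewrite setTI.
    by have := measurable_pair1 y measurableT mfar; rewrite setTI.
  apply: (@le_trans _ _ (2%:E * ((K (x, y))%:E * m S))).
    by rewrite muleCA muleC; apply: lee_wpmul2l; [rewrite lee_fin|exact: Hfar].
  rewrite EFinM -muleA; apply: lee_wpmul2l => //.
  rewrite -integral_cst// -ge0_integralD// -ge0_integralZl//; last 2 first.
    exact: emeasurable_funD.
    by move=> z _; exact: adde_ge0.
  apply: (@le_trans _ _ (\int[m]_(z in S) (C%:E * (h (x, z) + h (y, z))))).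
    apply: ge0_le_integral_nomeas => [z _|z [Qz [xz yz]]] /=; first by rewrite lee_fin.
    by rewrite /h !indicE !mem_set// !mulr1 -EFinD -EFinM lee_fin KC.
  apply: ge0_subset_integral => //.
  - by apply: measurable_funeM; exact: emeasurable_funD.
  - by move=> z _; apply: mule_ge0; [rewrite lee_fin|exact: adde_ge0].
  - exact: subIsetl.
have -> : m Q * \int[m]_(x in Q) \int[m]_(y in Q) (K (x, y) * w (x, y))%:E =
    \int[m]_(x in Q) (m Q * \int[m]_(y in Q) (K (x, y) * w (x, y))%:E).
  apply/esym/ge0_integralZl => //.
    by apply: (tonelli_on_measurable m mQ mQ (f := fun z => (K z * w z)%:E));
      [exact: measurable_funTS|].
  by move=> x _; apply: integral_ge0.
have mQQ : measurable (Q `*` Q) by exact: measurableX.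
have mHw : measurable_fun (Q `*` Q) (fun z => H z.1 * (w z)%:E).
  apply: emeasurable_funM; last exact: measurable_funTS.
  apply: (measurable_comp mQ _ mH); last exact: measurable_funTS.
  by move=> _ [z [Qz _] <-].
have mHw' : measurable_fun (Q `*` Q) (fun z => H z.2 * (w z)%:E).
  apply: emeasurable_funM; last exact: measurable_funTS.
  apply: (measurable_comp mQ _ mH); last exact: measurable_funTS.
  by move=> _ [z [_ Qz] <-].
have Hw0 z : 0 <= H z.1 * (w z)%:E by rewrite mule_ge0// lee_fin.
have Hw0' z : 0 <= H z.2 * (w z)%:E by rewrite mule_ge0// lee_fin.
apply: (@le_trans _ _ (\int[m]_(x in Q) \int[m]_(y in Q)
  ((2 * C)%:E * (H x * (w (x, y))%:E + H y * (w (x, y))%:E)))).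
  apply: ge0_le_integral_nomeas => x Qx; first by rewrite mule_ge0// integral_ge0.
  rewrite -ge0_integralZl//.
  apply: ge0_le_integral_nomeas => y Qy; first by rewrite mule_ge0.
  rewrite -ge0_muleDl// EFinM !muleA; apply: lee_wpmul2r; first by rewrite lee_fin.
  exact: avg.
have mHwx x : measurable_fun Q (fun y => H x * (w (x, y))%:E).
  exact: measurable_funeM.
have mHwx' x : measurable_fun Q (fun y => H y * (w (x, y))%:E).
  exact: emeasurable_funM.
have HwE : \int[m]_(x in Q) \int[m]_(y in Q) (H x * (w (x, y))%:E) <=
    W%:E * \int[m]_(x in Q) H x.
  rewrite -ge0_integralZl//.
  apply: ge0_le_integral_nomeas => x Qx; first by apply: integral_ge0 => y _; exact: (Hw0 (x, y)).
  rewrite ge0_integralZl//; last by move=> y _; rewrite lee_fin.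
  by rewrite muleC; apply: lee_wpmul2r => //; exact: HW.
have HwE' : \int[m]_(x in Q) \int[m]_(y in Q) (H y * (w (x, y))%:E) <=
    W%:E * \int[m]_(x in Q) H x.
  rewrite (tonelli_on m m mQ mQ mHw' Hw0')/=.
  under eq_integral do under eq_integral do rewrite wC.
  exact: HwE.
have Hxy0 x y : 0 <= H x * (w (x, y))%:E + H y * (w (x, y))%:E.
  by apply: adde_ge0; [exact: (Hw0 (x, y))|exact: (Hw0' (x, y))].
pose F1 x := \int[m]_(y in Q) (H x * (w (x, y))%:E).
pose F2 x := \int[m]_(y in Q) (H y * (w (x, y))%:E).
have mF1 : measurable_fun Q F1 := tonelli_on_measurable m mQ mQ mHw Hw0.
have mF2 : measurable_fun Q F2 := tonelli_on_measurable m mQ mQ mHw' Hw0'.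
have F10 x : 0 <= F1 x by apply: integral_ge0 => y _; exact: (Hw0 (x, y)).
have F20 x : 0 <= F2 x by apply: integral_ge0 => y _; exact: (Hw0' (x, y)).
have C20 : 0 <= (2 * C)%:E by rewrite lee_fin mulr_ge0.
have F12 x : \int[m]_(y in Q)
    ((2 * C)%:E * (H x * (w (x, y))%:E + H y * (w (x, y))%:E)) =
    (2 * C)%:E * (F1 x + F2 x).
  rewrite ge0_integralZl//; last exact: emeasurable_funD.
  congr (_ * _); apply: (ge0_integralD m mQ) => // y _.
    exact: (Hw0 (x, y)).
  exact: (Hw0' (x, y)).
have -> : \int[m]_(x in Q) \int[m]_(y in Q)
    ((2 * C)%:E * (H x * (w (x, y))%:E + H y * (w (x, y))%:E)) =
    (2 * C)%:E * (\int[m]_(x in Q) F1 x + \int[m]_(x in Q) F2 x).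
  transitivity (\int[m]_(x in Q) ((2 * C)%:E * (F1 x + F2 x))).
    by apply: eq_integral => x _; exact: F12.
  rewrite (ge0_integralZl m mQ (emeasurable_funD mF1 mF2))//; last first.
    by move=> x _; exact: (adde_ge0 (F10 x) (F20 x)).
  congr (_ * _).
  exact: (ge0_integralD m mQ (fun x _ => F10 x) mF1 (fun x _ => F20 x) mF2).
apply: (@le_trans _ _ ((2 * C)%:E * (W%:E * \int[m]_(x in Q) H x +
    W%:E * \int[m]_(x in Q) H x))).
  have HwD := leeD HwE HwE'.
  exact: (lee_wpmul2l C20 HwD).
have -> : (4 * C * W = 2 * C * (W + W))%R by ring.
rewrite -ge0_muleDl// -EFinD [in leRHS]EFinM -[in leRHS]muleA.
exact: lexx.
Qed.

End triple.

Section compare.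
Context dT (T : measurableType dT) (R : realType).
Variable m : {sigma_finite_measure set T -> \bar R}.
Variable delta : T * T -> R.
Hypothesis mdelta : measurable_fun setT delta.
Hypothesis delta0 : forall z, 0 <= delta z.
Hypothesis deltaC : forall x y, delta (x, y) = delta (y, x).
Local Notation mu := (@lebesgue_measure R).
Local Open Scope ereal_scope.

Definition energy (K : T * T -> R) (s : R) (Q : set T) : \bar R :=
  \int[m]_(x in Q) \int[m]_(y in Q) (K (x, y) * riesz s (delta (x, y)))%:E.

Definition cyl_energy (K : T * T -> R) (b : R) (Q : set T) (I : set R) : \bar R :=
  \int[m]_(x in Q) \int[mu]_(t in I) \int[m]_(y in Q) \int[mu]_(u in I)
    (K (x, y) * riesz b (hypot (delta (x, y)) (t - u)))%:E.

(** The properties of [K (x, y) = |f x - f y| ^ q] that the comparison uses. *)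
Record kernel_on (C0 : R) (K : T * T -> R) : Prop := KernelOn {
  kernel_measurable : measurable_fun setT K;
  kernel_ge0 : forall z, (0 <= K z)%R;
  kernel_diag : forall x y, delta (x, y) = 0%R -> K (x, y) = 0%R;
  kernel_triangle : forall x y z, (K (x, y) <= C0 * (K (x, z) + K (y, z)))%R
}.

Let mriesz s : measurable_fun setT (fun z => riesz s (delta z)).
Proof. exact: (measurableT_comp (measurable_riesz s)). Qed.

Let mKriesz C0 K s : kernel_on C0 K ->
  measurable_fun setT (fun z => K z * riesz s (delta z))%R.
Proof. by move=> KK; apply: measurable_funM => //; exact: kernel_measurable KK. Qed.

(** The lower bound is pointwise in [x], [y] and [t].  On the diagonal, where
    the values of [riesz] are conventional, [K] vanishes. *)
Lemma cyl_energy_ge (s D C0 : R) : (0 < D)%R -> exists2 c, (0 < c)%R &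
  forall K Q l a (b0 b1 : bool), kernel_on C0 K -> measurable Q -> (0 < l)%R ->
  (forall x y, Q x -> Q y -> (delta (x, y) <= D * l)%R) ->
  (c * l)%:E * energy K s Q <=
    cyl_energy K (s + 1) Q (side b0 b1 a l).
Proof.
move=> D0; have [c c0 Hc] := riesz_fiber_ge s D0.
exists c => // K Q l a b0 b1 KK mQ l0 HD.
rewrite EFinM -(itv_length a b0 b1 l0).
apply: (cyl_ge m (k := fun z => (K z * riesz s (delta z))%R)) => //.
- exact: mKriesz KK.
- by move=> z; rewrite mulr_ge0 ?riesz_ge0// (kernel_ge0 KK).
- exact: ltW.
move=> x y t Qx Qy /side_bounds tI.
have [d0|d0] := eqVneq (delta (x, y)) 0%R.
  rewrite (kernel_diag KK d0) mul0r mulr0.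
  by apply: integral_ge0 => u _; rewrite mul0r.
have dpos : (0 < delta (x, y))%R by rewrite lt_neqAle eq_sym d0 delta0.
have HI := Hc l _ t a b0 b1 dpos (HD _ _ Qx Qy) tI.
have mI := measurable_side b0 b1 a l.
under eq_integral do rewrite EFinM.
rewrite ge0_integralZl//; last 3 first.
- exact: measurable_riesz_hypot.
- by move=> u _; rewrite lee_fin riesz_ge0.
- by rewrite lee_fin (kernel_ge0 KK).
rewrite mulrCA EFinM; apply: lee_wpmul2l => //.
by rewrite lee_fin (kernel_ge0 KK).
Qed.

Lemma cyl_energy_le_gt0 (s C0 : R) : (0 < s)%R -> exists2 C, (0 < C)%R &
  forall K Q l a (b0 b1 : bool), kernel_on C0 K -> measurable Q -> (0 < l)%R ->
  cyl_energy K (s + 1) Q (side b0 b1 a l) <=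
    (C * l)%:E * energy K s Q.
Proof.
move=> s0; exists (2 + 2 / s)%R; first by rewrite addr_gt0// divr_gt0.
move=> K Q l a b0 b1 KK mQ l0.
have C0' : (0 <= 2 + 2 / s)%R by rewrite addr_ge0// divr_ge0// ltW.
rewrite EFinM -(itv_length a b0 b1 l0).
apply: (cyl_le m (k := fun z => (K z * riesz s (delta z))%R)) => //.
- exact: measurable_side.
- exact: mKriesz KK.
- by move=> z; rewrite mulr_ge0 ?riesz_ge0// (kernel_ge0 KK).
- move=> x y t _ _ _; apply: integral_ge0 => u _.
  by rewrite lee_fin mulr_ge0 ?riesz_ge0// (kernel_ge0 KK).
move=> x y t Qx Qy /side_bounds/andP[tI1 tI2].
have mI := measurable_side b0 b1 a l.
have [d0|d0] := eqVneq (delta (x, y)) 0%R.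
  rewrite (kernel_diag KK d0) mul0r mulr0.
  by rewrite integral0_eq// => u _; rewrite mul0r.
have dpos : (0 < delta (x, y))%R by rewrite lt_neqAle eq_sym d0 delta0.
under eq_integral do rewrite EFinM.
rewrite ge0_integralZl//; last 3 first.
- exact: measurable_riesz_hypot.
- by move=> u _; rewrite lee_fin riesz_ge0.
- by rewrite lee_fin (kernel_ge0 KK).
rewrite mulrCA EFinM; apply: lee_wpmul2l; first by rewrite lee_fin (kernel_ge0 KK).
apply: (@riesz_fiber_le _ s _ t l) => //.
move=> u /side_bounds/andP[u1 u2]; rewrite /= in_itv/=.
by apply/andP; split; lra.
Qed.

(** The properties of a cube of edge length [l] that the case [s <= 0] uses:
    [fat_far] says that at least half of the points are far from two given
    ones, and [fat_half] that the average of [|x - y| ^ (- 1/2)] over [y] is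
    of the order of [l ^ (- 1/2)]. *)
Record fat_set (D kappa W : R) (Q : set T) (l : R) : Prop := FatSet {
  fat_measurable : measurable Q;
  fat_gt0 : 0 < m Q;
  fat_fin : m Q < +oo;
  fat_diam : forall x y, Q x -> Q y -> (delta (x, y) <= D * l)%R;
  fat_far : forall x y, Q x -> Q y -> m Q <= 2%:E *
    m (Q `&` [set z | (kappa * l <= delta (x, z))%R /\ (kappa * l <= delta (y, z))%R]);
  fat_half : forall x, Q x ->
    \int[m]_(y in Q) (riesz 2^-1 (delta (x, y)))%:E <=
      (W * riesz 2^-1 l)%:E * m Q
}.

(** After the averaging of [triple_integral] only pairs with
    [kappa * l <= delta (x, y)] remain, and there
    [1 <= (kappa * l) ^ s * delta (x, y) ^ - s] because [s <= 0]. *)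
Lemma energy_half_le (s D kappa W C0 : R) : (s <= 0)%R -> (0 < kappa)%R ->
  (0 < W)%R -> (0 < C0)%R -> exists2 C, (0 < C)%R &
  forall K Q l, kernel_on C0 K -> (0 < l)%R -> fat_set D kappa W Q l ->
  energy K 2^-1 Q <= (C * (l `^ (s - 2^-1)))%:E * energy K s Q.
Proof.
move=> s0 k0 W0 C00.
exists (4 * C0 * W * kappa `^ s)%R.
  by rewrite !mulr_gt0// powR_gt0.
move=> K Q l KK l0 FQ.
have mQ := fat_measurable FQ.
have K0 := kernel_ge0 KK.
pose far := [set z : T * T | (kappa * l <= delta z)%R].
have mfar : measurable far.
  rewrite (_ : far = delta @^-1` `[(kappa * l)%R, +oo[).
    by rewrite -[X in measurable X]setTI; exact: mdelta.
  by apply/seteqP; split => z /=; rewrite in_itv/= andbT.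
pose M := fine (m Q).
have mQE : m Q = M%:E.
  by rewrite fineK// ge0_fin_numE// (fat_fin FQ).
have M0 : (0 < M)%R by rewrite -lte_fin -mQE (fat_gt0 FQ).
have rl : (0 < riesz 2^-1 l)%R by exact: riesz_gt0.
have H := @triple_integral _ _ _ m Q K (fun z => riesz 2^-1 (delta z)) far
  mQ mfar (kernel_measurable KK) K0 (mriesz _) (fun z => riesz_ge0 _ _)
  (fun x y => congr1 _ (deltaC x y)) C0 (W * riesz 2^-1 l * M)%R (ltW C00).
have {}H : m Q * energy K 2^-1 Q <=
  (4 * C0 * (W * riesz 2^-1 l * M))%:E *
  \int[m]_(x in Q) \int[m]_(y in Q) (K (x, y) * \1_far (x, y))%:E.
  apply: H.
  - by rewrite !mulr_ge0// ltW.
  - by move=> x y z _ _ _; exact: kernel_triangle KK x y z.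
  - by move=> x y Qx Qy; exact: fat_far FQ x y Qx Qy.
  - by move=> x Qx; rewrite EFinM -mQE; exact: fat_half FQ x Qx.
have Hfar : \int[m]_(x in Q) \int[m]_(y in Q) (K (x, y) * \1_far (x, y))%:E <=
    ((kappa * l) `^ s)%:E * energy K s Q.
  have mf := mKriesz s KK.
  rewrite /energy -ge0_integralZl//; last 3 first.
  - apply: (tonelli_on_measurable m mQ mQ
      (f := fun z => (K z * riesz s (delta z))%:E)).
      by apply/measurable_EFinP; exact: measurable_funTS.
    by move=> z; rewrite lee_fin mulr_ge0 ?riesz_ge0.
  - move=> x _; apply: integral_ge0 => y _.
    by rewrite lee_fin mulr_ge0 ?riesz_ge0.
  - by rewrite lee_fin powR_ge0.
  apply: ge0_le_integral_nomeas => x Qx.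
    by apply: integral_ge0 => y _; rewrite lee_fin mulr_ge0.
  rewrite -ge0_integralZl//; last 3 first.
  - apply/measurable_EFinP; apply: measurable_funTS.
    exact: (measurableT_comp mf (measurable_pair1 x)).
  - by move=> y _; rewrite lee_fin mulr_ge0 ?riesz_ge0.
  - by rewrite lee_fin powR_ge0.
  apply: ge0_le_integral_nomeas => y Qy; first by rewrite lee_fin mulr_ge0.
  rewrite -EFinM lee_fin mulrCA; apply: ler_wpM2l => //.
  rewrite indicE; case: (boolP ((x, y) \in far)) => [|_]; last first.
    by rewrite mulr_ge0 ?powR_ge0 ?riesz_ge0.
  rewrite inE /far /= => kd.
  have kl0 : (0 < kappa * l)%R by rewrite mulr_gt0.
  rewrite -ler_pdivrMl ?powR_gt0// mulr1 riesz_powR -powRN.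
  by rewrite ge0_ler_powR ?oppr_ge0// nnegrE ltW// (lt_le_trans kl0).
have M0' : 0 < M%:E by rewrite lte_fin.
rewrite -(lee_pmul2l (x := M%:E))// -mQE.
apply: (le_trans H).
have Ck0 : 0 <= (4 * C0 * (W * riesz 2^-1 l * M))%:E.
  by rewrite lee_fin !mulr_ge0// ltW.
apply: (le_trans (lee_wpmul2l Ck0 Hfar)).
rewrite mQE !muleA -!EFinM.
rewrite le_eqVlt; apply/orP; left; apply/eqP; congr (_%:E * _).
rewrite powRM ?ltW// riesz_powR powRD; first by ring.
by rewrite (gt_eqF l0) implybT.
Qed.

(** The hypotenuse [rho] is at most [M * l], and [2^-1 - s] is nonnegative, so
    that [rho ^ - (s + 1) <= (M * l) ^ (2^-1 - s) * rho ^ - (2^-1 + 1)];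
    [riesz_fiber_le] applies to the last factor, as its exponent exceeds 1. *)
Lemma cyl_energy_le_half (s D C0 : R) : (s <= 0)%R -> (0 < D)%R ->
  exists2 C, (0 < C)%R &
  forall K Q l a (b0 b1 : bool), kernel_on C0 K -> measurable Q -> (0 < l)%R ->
  (forall x y, Q x -> Q y -> (delta (x, y) <= D * l)%R) ->
  cyl_energy K (s + 1) Q (side b0 b1 a l) <=
    (C * l `^ (2^-1 - s) * l)%:E * energy K 2^-1 Q.
Proof.
move=> s0 D0; pose M := (2 * (D + 1))%R.
have M0 : (0 < M)%R by rewrite mulr_gt0// addr_gt0.
exists ((2 + 2 / 2^-1) * M `^ (2^-1 - s))%R.
  by rewrite mulr_gt0 ?powR_gt0// addr_gt0// divr_gt0// invr_gt0.
move=> K Q l a b0 b1 KK mQ l0 HD.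
have K0 := kernel_ge0 KK.
rewrite EFinM -(itv_length a b0 b1 l0).
apply: (cyl_le m (k := fun z => (K z * riesz 2^-1 (delta z))%R)) => //.
- exact: measurable_side.
- exact: mKriesz KK.
- by move=> z; rewrite mulr_ge0 ?riesz_ge0.
- by rewrite !mulr_ge0 ?powR_ge0// addr_ge0// divr_ge0// invr_ge0.
- move=> x y t _ _ _; apply: integral_ge0 => u _.
  by rewrite lee_fin mulr_ge0 ?riesz_ge0.
move=> x y t Qx Qy /side_bounds/andP[tI1 tI2].
have mI := measurable_side b0 b1 a l.
have [d0|d0] := eqVneq (delta (x, y)) 0%R.
  rewrite (kernel_diag KK d0) mul0r mulr0.
  by rewrite integral0_eq// => u _; rewrite mul0r.
have dpos : (0 < delta (x, y))%R by rewrite lt_neqAle eq_sym d0 delta0.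
under eq_integral do rewrite EFinM.
rewrite ge0_integralZl//; last 3 first.
- exact: measurable_riesz_hypot.
- by move=> u _; rewrite lee_fin riesz_ge0.
- by rewrite lee_fin.
rewrite mulrCA EFinM; apply: lee_wpmul2l; first by rewrite lee_fin.
set I := side _ _ _ _ in mI *.
have Il u : I u -> (t - l <= u <= t + l)%R.
  by move=> /side_bounds/andP[u1 u2]; apply/andP; split; lra.
have ML0 : (0 < M * l)%R by rewrite mulr_gt0.
apply: (@le_trans _ _ (\int[mu]_(u in I) (((M * l) `^ (2^-1 - s))%:E *
  (riesz (2^-1 + 1) (hypot (delta (x, y)) (t - u)))%:E))).
  apply: ge0_le_integral_nomeas => u Iu; first by rewrite lee_fin riesz_ge0.
  set rho := hypot _ _.
  have rho0 : (0 < rho)%R by apply: lt_le_trans dpos _; rewrite hypot_gel.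
  have rhoM : (rho <= M * l)%R.
    have := Il u Iu => /andP[u1 u2].
    rewrite /M -mulrA; apply: hypot_le => //.
      by rewrite ler_norml; apply/andP; split; nra.
    by apply: (le_trans (HD _ _ Qx Qy)); nra.
  rewrite -EFinM lee_fin !riesz_powR.
  rewrite (_ : (- (s + 1) = (2^-1 - s) + - (2^-1 + 1))%R); last by ring.
  rewrite powRD ?(gt_eqF rho0) ?implybT//.
  apply: ler_wpM2r; first exact: powR_ge0.
  apply: ge0_ler_powR => //; last 2 first.
  - by rewrite nnegrE ltW.
  - by rewrite nnegrE ltW.
  - by rewrite subr_ge0 (le_trans s0)// invr_ge0.
rewrite ge0_integralZl//; last 3 first.
- exact: measurable_riesz_hypot.
- by move=> u _; rewrite lee_fin riesz_ge0.
- by rewrite lee_fin powR_ge0.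
have h0 : (0 < 2^-1 :> R)%R by rewrite invr_gt0.
have HU := @riesz_fiber_le R 2^-1 (delta (x, y)) t l I h0 dpos mI.
apply: (@le_trans _ _ (((M * l) `^ (2^-1 - s))%:E *
    ((2 + 2 / 2^-1) * riesz 2^-1 (delta (x, y)))%:E)).
  apply: lee_wpmul2l; first by rewrite lee_fin powR_ge0.
  apply: HU => u Iu; rewrite /= in_itv/=; exact: Il.
rewrite -EFinM lee_fin (powRM _ (ltW M0) (ltW l0)).
by rewrite le_eqVlt; apply/orP; left; apply/eqP; ring.
Qed.

Lemma cyl_energy_le_le0 (s D kappa W C0 : R) : (s <= 0)%R -> (0 < D)%R ->
  (0 < kappa)%R -> (0 < W)%R -> (0 < C0)%R -> exists2 C, (0 < C)%R &
  forall K Q l a (b0 b1 : bool), kernel_on C0 K -> (0 < l)%R ->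
  fat_set D kappa W Q l ->
  cyl_energy K (s + 1) Q (side b0 b1 a l) <=
    (C * l)%:E * energy K s Q.
Proof.
move=> s0 D0 k0 W0 C00.
have [C1 C10 H1] := cyl_energy_le_half C0 s0 D0.
have [C2 C20 H2] := energy_half_le D s0 k0 W0 C00.
exists (C1 * C2)%R; first exact: mulr_gt0.
move=> K Q l a b0 b1 KK l0 FQ.
apply: (le_trans (H1 K Q l a b0 b1 KK (fat_measurable FQ) l0 (fat_diam FQ))).
have Ck0 : 0 <= (C1 * l `^ (2^-1 - s) * l)%:E.
  by rewrite lee_fin !mulr_ge0 ?powR_ge0// ltW.
apply: (le_trans (lee_wpmul2l Ck0 (H2 K Q l KK l0 FQ))).
rewrite muleA -EFinM le_eqVlt; apply/orP; left; apply/eqP; congr (_%:E * _).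
rewrite (_ : (s - 2^-1 = - (2^-1 - s))%R); last by ring.
rewrite powRN; have := powR_gt0 (2^-1 - s) l0 => ?.
by field; rewrite gt_eqF.
Qed.

End compare.

(** * Cubes of R^n *)
Section edist_facts.
Context {R : realType}.

(** The distance as a function on the product, the form in which its
    measurability is stated. *)
Definition edist_pairs d (z : Rn R d * Rn R d) : R := Defs.edist z.1 z.2.

Lemma edist_pairs_ge0 d (z : Rn R d * Rn R d) : 0 <= edist_pairs z.
Proof. exact: sqrtr_ge0. Qed.

Lemma edist_pairsC d (x y : Rn R d) : edist_pairs (x, y) = edist_pairs (y, x).
Proof.
rewrite /edist_pairs /Defs.edist /=; congr Num.sqrt; apply: eq_bigr => i _.
by rewrite -sqrrN opprB.
Qed.

Lemma edist_eq0 d (x y : Rn R d) : Defs.edist x y = 0 -> x = y.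
Proof.
move=> /eqP; rewrite sqrtr_eq0 => H.
have {}H : \sum_(i < d) (coor x i - coor y i) ^+ 2 = 0.
  by apply/eqP; rewrite eq_le H/= sumr_ge0// => i _; exact: sqr_ge0.
apply: eq_from_tnth => i.
have /eqP := @psumr_eq0P _ _ _ _ (fun i _ => sqr_ge0 (coor x i - coor y i)) H i isT.
by rewrite sqrf_eq0 subr_eq0 => /eqP.
Qed.

Lemma measurable_edist_pairs d : measurable_fun setT (@edist_pairs d).
Proof.
apply: (measurableT_comp (f := @Num.sqrt R)).
  by apply: continuous_measurable_fun; exact: sqrt_continuous.
apply: measurable_sum => i; apply: measurable_funX; apply: measurable_funB.
  exact: (measurableT_comp (measurable_coor i)).
exact: (measurableT_comp (measurable_coor i)).
Qed.

Lemma measurable_edist_pairsr d (x : Rn R d) :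
  measurable_fun setT (fun y => edist_pairs (x, y)).
Proof. exact: (measurableT_comp (@measurable_edist_pairs d) (measurable_pair1 x)). Qed.

Lemma coor_pair_widen n (x : Rn R n) (t : R) (i : 'I_n) :
  coor (pair_Rn x t) (widen_ord (leqnSn n) i) = coor x i.
Proof. exact: tnth_rcons_widen. Qed.

Lemma coor_pair_max n (x : Rn R n) (t : R) : coor (pair_Rn x t) ord_max = t.
Proof. exact: tnth_rcons_max. Qed.

Lemma edist_pair n (x y : Rn R n) (t u : R) :
  Defs.edist (pair_Rn x t) (pair_Rn y u) = hypot (Defs.edist x y) (t - u).
Proof.
rewrite /Defs.edist /hypot big_ord_recr/= !coor_pair_max; congr (Num.sqrt (_ + _)).
rewrite sqr_sqrtr; last by apply: sumr_ge0 => i _; exact: sqr_ge0.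
by apply: eq_bigr => i _; rewrite !coor_pair_widen.
Qed.

End edist_facts.

Section cubes.
Context {R : realType}.
Local Notation mu := (@lebesgue_measure R).

(** As a preimage, unlike the image [cylinder], this makes the membership of
    an element of R^(n+1) computable from its components. *)
Definition cyl n (Q : set (Rn R n)) (I : set R) : set (Rn R n.+1) :=
  split_Rn @^-1` (Q `*` I).

Lemma cyl_pair n (Q : set (Rn R n)) (I : set R) x t :
  cyl Q I (pair_Rn x t) <-> Q x /\ I t.
Proof. by rewrite /cyl /preimage /mkset split_pair_Rn. Qed.

Lemma cylinderE n (Q : set (Rn R n)) (I : set R) : cylinder Q I = cyl Q I.
Proof.
apply/seteqP; split=> [_ [x Qx [t It <-]]|x].
  by apply/cyl_pair.
rewrite -(pair_split_Rn x) => /cyl_pair[Qx It].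
by exists (split_Rn x).1 => //; exists (split_Rn x).2.
Qed.

Lemma is_cube_cyl n (Q : set (Rn R n)) l b0 b1 a : is_cube Q l ->
  is_cube (cyl Q (side b0 b1 a l)) l.
Proof.
move=> [l0 [aQ [lo [hi QE]]]]; split => //.
pose ext T (f : 'I_n -> T) (c : T) (i : 'I_n.+1) : T :=
  if insub (i : nat) is Some j then f j else c.
have ext1 T f c j : @ext T f c (widen_ord (leqnSn n) j) = f j.
  by rewrite /ext /= valK.
have ext2 T f c : @ext T f c ord_max = c.
  by rewrite /ext insubF//= ltnn.
exists (ext _ aQ a), (ext _ lo b0), (ext _ hi b1).
apply/seteqP; split => x; rewrite -(pair_split_Rn x).
  move=> /cyl_pair[]; rewrite QE => Qx It i.
  have [id|di] := ltnP i n.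
    have -> : i = widen_ord (leqnSn n) (Ordinal id) by exact: val_inj.
    by rewrite !ext1 coor_pair_widen; exact: Qx.
  by rewrite (ord_maxP di) !ext2 coor_pair_max.
move=> H; apply/cyl_pair; split.
  by rewrite QE => i; have := H (widen_ord (leqnSn n) i); rewrite !ext1 coor_pair_widen.
by have := H ord_max; rewrite !ext2 coor_pair_max.
Qed.

(** This is what permits induction on the dimension. *)
Lemma cube_cylP n (Q : set (Rn R n.+1)) l : is_cube Q l ->
  exists Q1 b0 b1 a, is_cube Q1 l /\ Q = cyl Q1 (side b0 b1 a l).
Proof.
move=> [l0 [a [lo [hi QE]]]].
pose w := widen_ord (leqnSn n).
exists [set x | forall i, coor x i \in
  Interval (BSide (lo (w i)) (a (w i))) (BSide (hi (w i)) (a (w i) + l))].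
exists (lo ord_max), (hi ord_max), (a ord_max); split.
  by split => //; exists (a \o w), (lo \o w), (hi \o w).
rewrite QE; apply/seteqP; split => x; rewrite -(pair_split_Rn x).
  move=> H; apply/cyl_pair; split.
    by move=> i; have := H (w i); rewrite coor_pair_widen.
  by have := H ord_max; rewrite coor_pair_max.
move=> /cyl_pair[Qx It] i.
have [id|di] := ltnP i n.
  have -> : i = w (Ordinal id) by exact: val_inj.
  by rewrite coor_pair_widen; exact: Qx.
by rewrite (ord_maxP di) coor_pair_max.
Qed.

Lemma cube_measure n (Q : set (Rn R n)) l : is_cube Q l ->
  measurable Q /\ lebesgue R n Q = (l ^+ n)%:E.
Proof.
elim: n Q => [|n IH] Q.
  move=> [l0 [a [lo [hi QE]]]].
  have -> : Q = setT by rewrite QE; apply/seteqP; split => // x _ [].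
  split; first exact: measurableT.
  have -> : lebesgue R 0 setT = borel_lebesgue R 0 setT.
    by apply: lebesgue_borelE.
  by rewrite /= diracT expr0.
move=> /cube_cylP[Q1 [b0 [b1 [a [cQ1 ->]]]]].
have l0 : 0 < l by case: cQ1.
have [mQ1 Q1E] := IH _ cQ1.
have mI : measurable (side b0 b1 a l) by exact: measurable_side.
have [mC CE] := lebesgue_rectangle mQ1 mI.
split => //; rewrite [LHS]CE Q1E itv_length// -EFinM.
by rewrite exprSr.
Qed.

Lemma cube_diam n (Q : set (Rn R n)) l x y : is_cube Q l -> Q x -> Q y ->
  edist_pairs (x, y) <= n.+1%:R * l.
Proof.
move=> [l0 [a [lo [hi QE]]]]; rewrite QE => Qx Qy.
have b i : (coor x i - coor y i) ^+ 2 <= l ^+ 2.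
  have /side_bounds/andP[? ?] := Qx i; have /side_bounds/andP[? ?] := Qy i.
  by nra.
have nl : 0 <= n.+1%:R * l by rewrite mulr_ge0// ltW.
rewrite -(ger0_norm nl) -sqrtr_sqr /edist_pairs/Defs.edist/=; apply: ler_wsqrtr.
apply: (@le_trans _ _ (\sum_(i < n) l ^+ 2)); first exact: ler_sum.
rewrite sumr_const card_ord -[leLHS]mulr_natl exprMn ler_wpM2r ?sqr_ge0//.
have : (n%:R <= n.+1%:R :> R) by rewrite ler_nat.
have : 1 <= n.+1%:R :> R by rewrite ler1n.
by nra.
Qed.

Local Open Scope ereal_scope.

(** Measurability is required for the product sigma-algebra of R^n and R,
    which is smaller than the one of R^(n+1). *)
Lemma integral_cyl n (Q : set (Rn R n)) (I : set R)
    (h : Rn R n.+1 -> \bar R) :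
  measurable Q -> measurable I ->
  measurable_fun setT (fun z : Rn R n * measurableTypeR R => h (pair_Rn z.1 z.2)) ->
  (forall z, 0 <= h z) ->
  \int[lebesgue R n.+1]_(x in cyl Q I) h x =
  \int[sf_lebesgue R n]_(x in Q) \int[mu]_(t in I) h (pair_Rn x t).
Proof.
move=> mQ mI mh h0.
have mQI : measurable (Q `*` (I : set (measurableTypeR R))) by exact: measurableX.
rewrite -(tonelli_on1 (sf_lebesgue R n) (@lebesgue_measure R) mQ mI
  (f := fun z => h (pair_Rn z.1 z.2)))//; last exact: measurable_funTS.
rewrite -(integral_split_Rn mQI (h := fun z => h (pair_Rn z.1 z.2)))//; last first.
  exact: measurable_funTS.
by apply: eq_integral => x _; rewrite pair_split_Rn.
Qed.

(** Both integral properties are read off the last coordinate, which is why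
    the dimension is positive: the points whose last coordinate is within
    [l / 8] of that of [x] or [y] fill at most half of the cube, and
    [|x - y|] is at least the difference of the last coordinates. *)
Lemma cube_fat n (Q : set (Rn R n.+1)) l : is_cube Q l ->
  fat_set (sf_lebesgue R n.+1) (@edist_pairs R n.+1) n.+2%:R 8^-1 4 Q l.
Proof.
move=> cQ; have [mQ QE] := cube_measure cQ.
have l0 : (0 < l)%R by case: cQ.
have [Q1 [b0 [b1 [a [cQ1 QC]]]]] := cube_cylP cQ.
have [mQ1 Q1E] := cube_measure cQ1.
have mI : measurable (side b0 b1 a l) by exact: measurable_side.
have lE : mu (side b0 b1 a l) = l%:E by exact: itv_length.
split => //.
- by rewrite [X in 0 < X]QE lte_fin exprn_gt0.
- by rewrite [X in X < _]QE ltry.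
- by move=> x y; exact: cube_diam.
- move=> x y Qx Qy.
  pose B (t : R) : set R := `](t - 8^-1 * l)%R, (t + 8^-1 * l)%R[%classic.
  have BE t : mu (B t) = (4^-1 * l)%:E.
    have l8 : (0 < 4^-1 * l)%R by rewrite mulr_gt0.
    rewrite /B (_ : (t + 8^-1 * l = t - 8^-1 * l + 4^-1 * l)%R); last by field.
    exact: itv_length.
  have mB t : measurable (B t) by exact: measurable_itv.
  pose t1 := (split_Rn x).2; pose t2 := (split_Rn y).2.
  pose J := side b0 b1 a l `\` (B t1 `|` B t2).
  have mJ : measurable J by apply: measurableD => //; exact: measurableU.
  have JE : l%:E <= 2%:E * mu J.
    have H : l%:E <= mu J + (4^-1 * l + 4^-1 * l)%:E.
      rewrite -lE EFinD -{1}(BE t1) -(BE t2).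
      apply: (@le_trans _ _ (mu (J `|` (B t1 `|` B t2)))).
        have mBB : measurable (B t1 `|` B t2) by exact: measurableU.
        have mU : measurable (J `|` (B t1 `|` B t2)) by exact: measurableU.
        apply: le_measure; [by rewrite inE|by rewrite inE|] => u Iu.
         have [Bu|nBu] := pselect ((B t1 `|` B t2) u); first by right.
        by left.
      have mBB : measurable (B t1 `|` B t2) by exact: measurableU.
      apply: (le_trans (measureU2 mu mJ mBB)); apply: leeD.
        exact: lexx.
      exact: (measureU2 mu (mB t1) (mB t2)).
    have Joo : mu J < +oo.
      apply: (@le_lt_trans _ _ (mu (side b0 b1 a l))); last by rewrite lE ltry.
      by apply: le_measure; rewrite ?inE//; exact: subDsetl.
    have Jfin : mu J \is a fin_num by rewrite ge0_fin_numE.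
    move: H; rewrite -(fineK Jfin) -EFinD -EFinM !lee_fin; lra.
  have [mC CE] := lebesgue_rectangle mQ1 mJ.
  have sub : cyl Q1 J `<=` Q `&` [set z |
      (8^-1 * l <= edist_pairs (x, z))%R /\ (8^-1 * l <= edist_pairs (y, z))%R].
    move=> z; rewrite -(pair_split_Rn z) => /cyl_pair[Q1z [Iz nB]].
    split; first by rewrite QC; apply/cyl_pair.
    have far w : ~ B (split_Rn w).2 (split_Rn z).2 ->
        (8^-1 * l <= edist_pairs (w, pair_Rn (split_Rn z).1 (split_Rn z).2))%R.
      move=> nBw; rewrite -(pair_split_Rn w) /edist_pairs /= edist_pair.
      apply: le_trans (hypot_ger _ _); rewrite leNgt ltr_norml.
      by apply/negP => /andP[w1 w2]; apply: nBw; rewrite /B/= in_itv/=; lra.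
    by split; apply: far => Bw; apply: nB; [left|right].
  rewrite [leLHS]QE.
  apply: (@le_trans _ _ (2%:E * lebesgue R n.+1 (cyl Q1 J))).
    rewrite [X in _ <= 2%:E * X]CE Q1E exprSr EFinM muleCA.
    by apply: lee_wpmul2l; rewrite // lee_fin exprn_ge0// ltW.
  apply: lee_wpmul2l => //; apply: le_measure; rewrite ?inE//.
  have mfar w : measurable [set z : Rn R n.+1 | (8^-1 * l <= edist_pairs (w, z))%R].
    rewrite [X in measurable X](_ : _ =
      (fun z => edist_pairs (w, z)) @^-1` `[(8^-1 * l)%R, +oo[).
      rewrite -[X in measurable X]setTI.
      exact: (measurable_edist_pairsr w).
    by apply/seteqP; split => z /=; rewrite in_itv/= andbT.
  by apply: measurableI => //; apply: measurableI; exact: mfar.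
- move=> x; rewrite -(pair_split_Rn x).
  move: (split_Rn x).1 ((split_Rn x).2 : R) => {}x t.
  rewrite {1}QC => /cyl_pair[Q1x /side_bounds/andP[t1 t2]].
  have hE z : edist_pairs (pair_Rn x t, pair_Rn z.1 z.2) =
      hypot (edist_pairs (x, z.1)) (t - z.2) by exact: edist_pair.
  have mh : measurable_fun setT (fun z : Rn R n * measurableTypeR R =>
      (riesz 2^-1 (edist_pairs (pair_Rn x t, pair_Rn z.1 z.2)))%:E).
    apply/measurable_EFinP; apply: (measurableT_comp (measurable_riesz _)).
    under eq_fun do rewrite hE.
    apply: measurable_hypot; last exact: measurable_funB.
    exact: (measurableT_comp (measurable_edist_pairsr x) measurable_fst).
  rewrite [X in X <= _](_ : _ = \int[sf_lebesgue R n]_(y in Q1)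
      \int[mu]_(u in side b0 b1 a l)
        (riesz 2^-1 (hypot (edist_pairs (x, y)) (t - u)))%:E).
    apply: (@le_trans _ _ (\int[sf_lebesgue R n]_(y in Q1)
        (cst (4 * l `^ 2^-1)%:E y))).
      apply: ge0_le_integral_nomeas => y Q1y.
        by apply: integral_ge0 => u _; rewrite lee_fin riesz_ge0.
      apply: riesz_half_hypot => //; first exact: sqrtr_ge0.
      move=> u /side_bounds/andP[u1 u2].
      by rewrite /= in_itv/=; apply/andP; split; lra.
    rewrite integral_cst// [X in _ <= _ * X]QE [X in _ * X <= _]Q1E -!EFinM lee_fin.
    rewrite exprSr riesz_powR.
    have -> : (l `^ 2^-1 = l `^ (- 2^-1) * l)%R.
      rewrite -[X in (_ = _ * X)%R](powRr1 (ltW l0)) -powRD.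
        by congr powR; field.
      by rewrite (gt_eqF l0) implybT.
    by rewrite le_eqVlt; apply/orP; left; apply/eqP; ring.
  rewrite QC.
  rewrite (integral_cyl (h := fun y => (riesz 2^-1 (edist_pairs (pair_Rn x t, y)))%:E) mQ1 mI mh).
    apply: eq_integral => y _; apply: eq_integral => u _.
    by rewrite (hE (y, u)).
  by move=> z; rewrite lee_fin riesz_ge0.
Qed.

End cubes.

(** * The energies of the seminorm *)
Section JNQ_energy_facts.
Context {R : realType}.
Local Notation mu := (@lebesgue_measure R).

Definition diffq d (q : R) (g : Rn R d -> R) (z : Rn R d * Rn R d) : R :=
  `|g z.1 - g z.2| `^ q.

(** The triangle inequality bounds [|g x - g y|] by twice the larger of
    [|g x - g z|] and [|g y - g z|], whence the constant [2 ^ q]. *)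
Lemma diffq_kernel d (q : R) (g : Rn R d -> R) : 0 < q ->
  measurable_fun setT g -> kernel_on (@edist_pairs R d) (2 `^ q) (diffq q g).
Proof.
move=> q0 mg; split.
- apply: (measurableT_comp (measurable_powR q)).
  apply: measurableT_comp => //; apply: measurable_funB.
    exact: (measurableT_comp mg).
  exact: (measurableT_comp mg).
- by move=> z; exact: powR_ge0.
- by move=> x y /(@edist_eq0 _ _ x y) ->; rewrite /diffq subrr normr0 powR0// gt_eqF.
- move=> x y z; rewrite /diffq /=.
  set a := `|g x - g z|; set b := `|g y - g z|.
  have ab : `|g x - g y| <= a + b.
    rewrite /b (distrC (g y)) (_ : g x - g y = (g x - g z) + (g z - g y)) ?ler_normD//.
    by ring.
  have a0 : 0 <= a by exact: normr_ge0.
  have b0 : 0 <= b by exact: normr_ge0.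
  have pa := powR_ge0 a q; have pb := powR_ge0 b q.
  have aux c : 0 <= c -> `|g x - g y| <= 2 * c ->
      `|g x - g y| `^ q <= 2 `^ q * c `^ q.
    move=> c0 gc; rewrite -powRM//; apply: ge0_ler_powR => //; first exact: ltW.
    by rewrite nnegrE mulr_ge0.
  have [le_ab|/ltW le_ba] := leP a b.
  + apply: (le_trans (aux b b0 _)); first by lra.
    by rewrite ler_wpM2l ?powR_ge0// lerDr.
  + apply: (le_trans (aux a a0 _)); first by lra.
    by rewrite ler_wpM2l ?powR_ge0// lerDl.
Qed.

Local Open Scope ereal_scope.

Lemma JNQ_integrandE d (q s : R) (g : Rn R d -> R) x y :
  `|(g x)%:E - (g y)%:E| `^ q * (((Defs.edist x y) `^ s)^-1)%:E =
  (diffq q g (x, y) * riesz s (edist_pairs (x, y)))%:E.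
Proof. by rewrite -EFinB abse_EFin poweR_EFin -EFinM. Qed.

Lemma JNQ_energyE d (q alpha : R) (g : Rn R d -> R) Q :
  JNQ_energy q alpha (EFin \o g) Q =
  energy (sf_lebesgue R d) (@edist_pairs R d) (diffq q g) (d%:R + q * alpha)%R Q.
Proof.
apply: eq_integral => x _; apply: eq_integral => y _; exact: JNQ_integrandE.
Qed.

Lemma JNQ_energy_ge0 d (q alpha : R) (f : Rn R d -> \bar R) Q :
  0 <= JNQ_energy q alpha f Q.
Proof.
apply: integral_ge0 => x _; apply: integral_ge0 => y _.
by rewrite mule_ge0 ?poweR_ge0// lee_fin invr_ge0 powR_ge0.
Qed.

Lemma measurable_split_Rn1 n : measurable_fun setT (fun X : Rn R n.+1 => (split_Rn X).1).
Proof. exact: (measurableT_comp measurable_fst measurable_split_Rn). Qed.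

Lemma JNQ_energy_cyl n (q alpha : R) (g : Rn R n -> R) Q (I : set R) :
  (0 < q)%R -> measurable_fun setT g -> measurable Q -> measurable I ->
  JNQ_energy q alpha (fun X : Rn R n.+1 => (g (split_Rn X).1)%:E) (cyl Q I) =
  cyl_energy (sf_lebesgue R n) (@edist_pairs R n) (diffq q g)
    (n%:R + q * alpha + 1)%R Q I.
Proof.
move=> q0 mg mQ mI.
pose G (X : Rn R n.+1) := g (split_Rn X).1.
have mG : measurable_fun setT G by exact: (measurableT_comp mg (@measurable_split_Rn1 n)).
pose s := (n%:R + q * alpha)%R.
have sE : (n.+1%:R + q * alpha = s + 1)%R by rewrite /s -natr1; ring.
have GE x t : G (pair_Rn x t) = g x by rewrite /G split_pair_Rn.
have Kg := diffq_kernel q0 mg.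
pose h z := (diffq q G z * riesz (s + 1) (edist_pairs z))%R.
pose P := (Rn R n * measurableTypeR R)%type.
pose k (w : P * P) := (diffq q g (w.1.1, w.2.1) *
  riesz (s + 1) (hypot (edist_pairs (w.1.1, w.2.1)) (w.1.2 - w.2.2)))%R.
have hk x t y u : h (pair_Rn x t, pair_Rn y u) = k ((x, t), (y, u)).
  by rewrite /h /k /diffq /= !GE /edist_pairs /= edist_pair.
have mk : measurable_fun setT k.
  have mfirst : measurable_fun setT (fun w : P * P => (w.1.1, w.2.1)).
    by apply: measurable_fun_pair; exact: measurableT_comp.
  apply: measurable_funM.
    exact: (measurableT_comp (kernel_measurable Kg) mfirst).
  apply: (measurableT_comp (measurable_riesz _)).
  apply: measurable_hypot.
    exact: (measurableT_comp (@measurable_edist_pairs R n) mfirst).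
  by apply: measurable_funB; exact: measurableT_comp.
have mkE : measurable_fun setT (fun w => (k w)%:E) by apply/measurable_EFinP.
have k0 w : 0 <= (k w)%:E by rewrite lee_fin mulr_ge0 ?riesz_ge0 ?powR_ge0.
have mQI : measurable (Q `*` (I : set (measurableTypeR R))) by exact: measurableX.
have mC : measurable (cyl Q I) by have [] := lebesgue_rectangle mQ mI.
rewrite -/G (JNQ_energyE _ _ G) sE.
pose Hin X := \int[sf_lebesgue R n.+1]_(Y in cyl Q I) (h (X, Y))%:E.
have Hin0 X : 0 <= Hin X.
  by apply: integral_ge0 => Y _; rewrite lee_fin mulr_ge0 ?riesz_ge0 ?powR_ge0.
have HinE x t : Hin (pair_Rn x t) =
    \int[sf_lebesgue R n \x mu]_(z in Q `*` I) (k ((x, t), z))%:E.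
  rewrite -(integral_split_Rn mQI (h := fun z => (k ((x, t), z))%:E)) => [||z _].
  - apply: eq_integral => Y _; rewrite -{1}(pair_split_Rn Y) hk.
    by case: (split_Rn Y).
  - by apply: measurable_funTS; exact: (measurableT_comp mkE (measurable_pair1 _)).
  - exact: k0.
have mHin : measurable_fun setT (fun z : P => Hin (pair_Rn z.1 z.2)).
  (* Tonelli over R^(n+1) itself in the second variable, through the map
     that splits off its last coordinate. *)
  pose r (w : P * Rn R n.+1) := (w.1, split_Rn w.2).
  have mr : measurable_fun setT r.
    apply: measurable_fun_pair; first exact: measurable_fst.
    exact: (measurableT_comp measurable_split_Rn measurable_snd).
  apply: (eq_measurable_fun (fun z =>
    \int[sf_lebesgue R n.+1]_(Y in cyl Q I) (k (r (z, Y)))%:E)).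
    move=> [x t] _ /=; apply: eq_integral => Y _.
    rewrite -[in RHS](pair_split_Rn Y) hk /r.
    by case: (split_Rn Y).
  apply: (tonelli_on_measurable (sf_lebesgue R n.+1) measurableT mC
    (f := fun w => (k (r w))%:E)) => [|w]; last exact: k0.
  by apply: measurable_funTS; exact: (measurableT_comp mkE mr).
transitivity (\int[lebesgue R n.+1]_(X in cyl Q I) Hin X) => //.
rewrite (integral_cyl (h := Hin) mQ mI mHin Hin0).
apply: eq_integral => x _; apply: eq_integral => t _.
rewrite HinE (tonelli_on1 (sf_lebesgue R n) mu mQ mI
  (f := fun z => (k ((x, t), z))%:E))//.
by apply: measurable_funTS; exact: (measurableT_comp mkE (measurable_pair1 _)).
Qed.

(** This reduces the energy of an extended real function that is finite almost
    everywhere to that of a real function. *)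
Lemma JNQ_energy_ae d (q alpha : R) (f g : Rn R d -> \bar R) Q :
  measurable Q -> measurable_fun Q f -> measurable_fun Q g ->
  {ae lebesgue R d, forall x, Q x -> f x = g x} ->
  JNQ_energy q alpha f Q = JNQ_energy q alpha g Q.
Proof.
move=> mQ mf mg fg.
pose s := (d%:R + q * alpha)%R.
pose k (f : Rn R d -> \bar R) (z : Rn R d * Rn R d) : \bar R :=
  `|f z.1 - f z.2| `^ q * (riesz s (edist_pairs z))%:E.
have k0 h z : 0 <= k h z by rewrite mule_ge0 ?poweR_ge0// lee_fin riesz_ge0.
have mk h : measurable_fun Q h -> measurable_fun (Q `*` Q) (k h).
  move=> mh; apply: emeasurable_funM; last first.
    apply/measurable_EFinP; apply: measurable_funTS.
    exact: (measurableT_comp (measurable_riesz _) (@measurable_edist_pairs R d)).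
  apply: (measurableT_comp (measurable_poweR q)).
  apply: measurableT_comp => //; apply: emeasurable_funB.
    apply: (measurable_comp mQ _ mh); last exact: measurable_funTS.
    by move=> _ [z [Qz _] <-].
  apply: (measurable_comp mQ _ mh); last exact: measurable_funTS.
  by move=> _ [z [_ Qz] <-].
have mkx h x : measurable_fun Q h -> Q x -> measurable_fun Q (fun y => k h (x, y)).
  move=> mh Qx; apply: (measurable_comp (measurableX mQ mQ) _ (mk h mh)).
    by move=> _ [y Qy <-].
  by apply: measurable_funTS; exact: measurable_pair1.
have mH h : measurable_fun Q h ->
    measurable_fun Q (fun x => \int[sf_lebesgue R d]_(y in Q) k h (x, y)).
  by move=> mh; exact: (tonelli_on_measurable _ mQ mQ (mk h mh) (k0 h)).
apply: (ge0_ae_eq_integral (mu := lebesgue R d) mQ (mH f mf) (mH g mg)).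
- by move=> x _; apply: integral_ge0 => y _; exact: k0.
- by move=> x _; apply: integral_ge0 => y _; exact: k0.
have fg' := fg; apply: filterS fg' => x + Qx => /(_ Qx) fgx.
apply: (ge0_ae_eq_integral (mu := lebesgue R d) mQ (mkx f x mf Qx) (mkx g x mg Qx)).
- by move=> y _; exact: k0.
- by move=> y _; exact: k0.
by apply: filterS fg => y + Qy => /(_ Qy) fgy; rewrite /k /= fgx fgy.
Qed.

End JNQ_energy_facts.

(** * Interiors of cubes *)
Section interiors.
Context {R : realType}.

Definition rowv d (x : Rn R d) : 'rV[R]_d := \row_i coor x i.

Lemma rowv_surj d (v : 'rV[R]_d) : exists x : Rn R d, v = rowv x.
Proof.
exists ([tuple v 0 i | i < d] : Rn R d); apply/rowP => i.
by rewrite mxE /coor tnth_mktuple.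
Qed.

Lemma rowv_inj d : injective (@rowv d).
Proof.
move=> x y /rowP xy; apply: eq_from_tnth => i.
by have := xy i; rewrite !mxE.
Qed.

(** The topology of row vectors is that of the maximum distance. *)
Lemma interior_rVP d (Q : set (Rn R d)) (x : Rn R d) :
  interior_in_rV Q (rowv x) <->
  exists2 e, 0 < e & forall w, (forall i, `|coor x i - coor w i| < e) -> Q w.
Proof.
rewrite /interior_in_rV /interior; split.
  move=> /nbhs_ballP[e /= e0 He]; exists e => // w Hw.
  have /He[w' Qw' /rowv_inj <-//] : ball (rowv x) e (rowv w).
  by split => // i j; rewrite !mxE /ball /=; exact: Hw.
move=> [e e0 He]; apply/nbhs_ballP; exists e => //= v [_ Hv].
have [w vw] := rowv_surj v; exists w; last exact/esym.
apply: He => i; have := Hv 0 i; rewrite vw !mxE; exact.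
Qed.

Lemma interior_sub d (Q : set (Rn R d)) (x : Rn R d) :
  interior_in_rV Q (rowv x) -> Q x.
Proof.
move=> /interior_rVP[e e0]; apply => i; by rewrite subrr normr0.
Qed.

Definition disjoint_interiors d (Q Q' : set (Rn R d)) : Prop :=
  interior_in_rV Q `&` interior_in_rV Q' = set0.

Lemma disjoint_interiorsP d (Q Q' : set (Rn R d)) :
  disjoint_interiors Q Q' <->
  forall x, interior_in_rV Q (rowv x) -> interior_in_rV Q' (rowv x) -> False.
Proof.
split=> [H x Qx Q'x|H].
  by have : (interior_in_rV Q `&` interior_in_rV Q') (rowv x) by []; rewrite H.
apply/seteqP; split => // v [].
by have [x ->] := rowv_surj v; exact: H.
Qed.

Lemma cube_interior d (Q : set (Rn R d)) l : is_cube Q l ->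
  exists x, interior_in_rV Q (rowv x).
Proof.
move=> [l0 [a [lo [hi QE]]]].
pose x : Rn R d := [tuple a i + l / 2 | i < d].
have xE i : coor x i = a i + l / 2 by rewrite /coor tnth_mktuple.
exists x; apply/interior_rVP; exists (l / 2); first by rewrite divr_gt0.
move=> w Hw; rewrite QE => i; have := Hw i; rewrite xE ltr_norml => /andP[w1 w2].
by apply: in_side; lra.
Qed.

(** Only the slice of a neighbourhood at height [t] is used. *)
Lemma cyl_interior_proj n (Q : set (Rn R n)) (I : set R) (x : Rn R n) t :
  interior_in_rV (cyl Q I) (rowv (pair_Rn x t)) -> interior_in_rV Q (rowv x) /\ I t.
Proof.
move=> H; split; last by have /interior_sub/cyl_pair[] := H.
move/interior_rVP : H => [e e0 He]; apply/interior_rVP; exists e => // w Hw.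
have /cyl_pair[]// : cyl Q I (pair_Rn w t).
apply: He => i; have [id|di] := ltnP i n.
  have -> : i = widen_ord (leqnSn n) (Ordinal id) by exact: val_inj.
  by rewrite !coor_pair_widen.
by rewrite (ord_maxP di) !coor_pair_max subrr normr0.
Qed.

Lemma cyl_interior n (Q : set (Rn R n)) b0 b1 (a l : R) (x : Rn R n) t :
  interior_in_rV Q (rowv x) -> a < t < a + l ->
  interior_in_rV (cyl Q (side b0 b1 a l)) (rowv (pair_Rn x t)).
Proof.
move=> /interior_rVP[e e0 He] /andP[t1 t2]; apply/interior_rVP.
exists (Num.min e (Num.min (t - a) (a + l - t))).
  by rewrite !lt_min e0/=; apply/andP; split; lra.
move=> w; rewrite -(pair_split_Rn w) => Hw; apply/cyl_pair; split.
  apply: He => i; have := Hw (widen_ord (leqnSn n) i).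
  by rewrite !coor_pair_widen !lt_min => /and3P[].
have := Hw ord_max; rewrite !coor_pair_max !lt_min => /and3P[_].
rewrite !ltr_norml => /andP[u1 u2] /andP[u3 u4].
by apply: in_side; lra.
Qed.

End interiors.

(** * Summands of a cube and of a cube above it *)
Lemma ge0_le_poweR (R : realType) (r : R) (x y : \bar R) : 0 <= r ->
  (0 <= x -> x <= y -> x `^ r <= y `^ r)%E.
Proof.
move=> r0 x0 xy; apply: gt0_ler_poweR => //; rewrite ?in_itv/= ?leey ?andbT//.
exact: le_trans xy.
Qed.

Section lift.
Context {R : realType}.
Local Open Scope ereal_scope.

(** The upper bound is pointwise for [s > 0], and otherwise goes through a
    third point. *)
Lemma JNQ_energy_compare n (q alpha : R) : (1 <= n)%N -> (0 < q)%R ->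
  exists c C : R, [/\ (0 < c)%R, (0 < C)%R &
  forall (Q : set (Rn R n)) l b0 b1 a (g : Rn R n -> R),
  is_cube Q l -> measurable_fun setT g ->
  (c * l)%:E * JNQ_energy q alpha (EFin \o g) Q <=
    JNQ_energy q alpha (fun X : Rn R n.+1 => (g (split_Rn X).1)%:E)
      (cyl Q (side b0 b1 a l)) <=
  (C * l)%:E * JNQ_energy q alpha (EFin \o g) Q].
Proof.
case: n => // n _ q0.
pose m := sf_lebesgue R n.+1; pose s := (n.+1%:R + q * alpha)%R.
have md := @measurable_edist_pairs R n.+1.
have d0 := @edist_pairs_ge0 R n.+1.
have dC := @edist_pairsC R n.+1.
have D0 : (0 < n.+2%:R :> R)%R by rewrite ltr0n.
have C00 : (0 < 2 `^ q :> R)%R by exact: powR_gt0.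
have [c c0 Hc] := cyl_energy_ge m md d0 s (2 `^ q) D0.
have [C [C0 HC]] : exists C, (0 < C)%R /\ forall (K : Rn R n.+1 * Rn R n.+1 -> R)
    Q l a b0 b1, kernel_on (@edist_pairs R n.+1) (2 `^ q) K -> is_cube Q l ->
    cyl_energy m (@edist_pairs R n.+1) K (s + 1) Q (side b0 b1 a l) <=
      (C * l)%:E * energy m (@edist_pairs R n.+1) K s Q.
  have [s0|s0] := ltP 0%R s.
    have [C C0 HC] := cyl_energy_le_gt0 m md d0 (2 `^ q) s0.
    exists C; split => // K Q l a b0 b1 KK cQ.
    have [mQ _] := cube_measure cQ; have l0 : (0 < l)%R by case: cQ.
    exact: (HC K Q l a b0 b1 KK mQ l0).
  have k0 : (0 < 8^-1 :> R)%R by rewrite invr_gt0.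
  have W0 : (0 < 4 :> R)%R by [].
  have [C C0 HC] := cyl_energy_le_le0 m md d0 dC s0 D0 k0 W0 C00.
  exists C; split => // K Q l a b0 b1 KK cQ.
  have l0 : (0 < l)%R by case: cQ.
  exact: (HC K Q l a b0 b1 KK l0 (cube_fat cQ)).
exists c, C; split => // Q l b0 b1 a g cQ mg.
have [mQ _] := cube_measure cQ; have l0 : (0 < l)%R by case: cQ.
have KK := diffq_kernel q0 mg.
have mI : measurable (side b0 b1 a l) by exact: measurable_side.
rewrite JNQ_energyE (JNQ_energy_cyl alpha q0 mg mQ mI); apply/andP; split.
  apply: (Hc _ Q l a b0 b1 KK mQ l0) => x y; exact: cube_diam.
exact: HC.
Qed.

Definition JNQ_term d (p q alpha : R) (f : Rn R d -> \bar R) (Q : set (Rn R d))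
    : \bar R :=
  lebesgue R d Q *
    (lebesgue R d Q `^ (q * alpha / d%:R - 1) * JNQ_energy q alpha f Q) `^ (p / q).

Lemma JNQ_term_ge0 d (p q alpha : R) (f : Rn R d -> \bar R) Q :
  0 <= JNQ_term p q alpha f Q.
Proof. by rewrite mule_ge0 ?poweR_ge0. Qed.

Lemma JNQ_term_cube d (p q alpha : R) (f : Rn R d -> \bar R) Q l :
  (1 <= d)%N -> is_cube Q l ->
  JNQ_term p q alpha f Q =
  (l ^+ d)%:E * ((l `^ (q * alpha - d%:R))%:E * JNQ_energy q alpha f Q) `^ (p / q).
Proof.
move=> d1 cQ; have [_ QE] := cube_measure cQ; have l0 : (0 < l)%R by case: cQ.
rewrite /JNQ_term QE; congr (_ * (_ * _) `^ _).
rewrite poweR_EFin -powR_mulrn ?ltW// -powRrM; congr ((_ `^ _)%:E).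
by field; rewrite pnatr_eq0 -lt0n.
Qed.

(** The powers of the edge length match: [l ^ (q alpha - n)] is
    [l ^ (q alpha - (n + 1))] times [l], which absorbs the factor [l] between
    the energies, and one factor [l] remains from the measure of the cube. *)
Lemma JNQ_term_compare n (p q alpha : R) :
  (1 <= n)%N -> (1 <= p)%R -> (1 <= q)%R ->
  exists c C : R, [/\ (0 < c)%R, (0 < C)%R &
  forall (Q : set (Rn R n)) l b0 b1 a (g : Rn R n -> R),
  is_cube Q l -> measurable_fun setT g ->
  (c * l)%:E * JNQ_term p q alpha (EFin \o g) Q <=
    JNQ_term p q alpha (fun X : Rn R n.+1 => (g (split_Rn X).1)%:E)
      (cyl Q (side b0 b1 a l)) <=
  (C * l)%:E * JNQ_term p q alpha (EFin \o g) Q].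
Proof.
move=> n1 p1 q1; have q0 : (0 < q)%R by lra.
have [c [C [c0 C0 H]]] := JNQ_energy_compare alpha n1 q0.
exists (c `^ (p / q))%R, (C `^ (p / q))%R; split; [exact: powR_gt0|exact: powR_gt0|].
move=> Q l b0 b1 a g cQ mg; have l0 : (0 < l)%R by case: cQ.
have pq0 : (0 <= p / q)%R by rewrite divr_ge0; lra.
have /andP[H1 H2] := H Q l b0 b1 a g cQ mg.
rewrite (JNQ_term_cube p q alpha _ n1 cQ).
rewrite (JNQ_term_cube p q alpha _ _ (is_cube_cyl b0 b1 a cQ))//.
set E := JNQ_energy q alpha (EFin \o g) Q in H1 H2 *.
set E' := JNQ_energy q alpha _ (cyl _ _) in H1 H2 *.
have E0 : 0 <= E by exact: JNQ_energy_ge0.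
have E'0 : 0 <= E' by exact: JNQ_energy_ge0.
set u := (l `^ (q * alpha - n%:R))%R.
set v := (l `^ (q * alpha - n.+1%:R))%R.
have uv : (u = v * l)%R.
  rewrite /u (_ : (q * alpha - n%:R = q * alpha - n.+1%:R + 1)%R); last first.
    by rewrite -natr1; ring.
  by rewrite powRD ?(gt_eqF l0) ?implybT// powRr1// ltW.
have u0 : (0 <= u)%R by exact: powR_ge0.
have v0 : (0 <= v)%R by exact: powR_ge0.
have key k : (0 <= k)%R -> (k `^ (p / q) * l)%:E *
    ((l ^+ n)%:E * (u%:E * E) `^ (p / q)) =
    (l ^+ n.+1)%:E * (v%:E * ((k * l)%:E * E)) `^ (p / q).
  move=> k0; rewrite uv.
  have -> : v%:E * ((k * l)%:E * E) = k%:E * ((v * l)%:E * E).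
    by rewrite !muleA -!EFinM; congr (_%:E * _); ring.
  rewrite [in RHS]poweRM ?lee_fin//; last first.
    by rewrite mule_ge0// lee_fin mulr_ge0// ltW.
  rewrite poweR_EFin !muleA -!EFinM; congr (_%:E * _).
  by rewrite exprSr; ring.
have ln0 : 0 <= (l ^+ n.+1)%:E by rewrite lee_fin exprn_ge0// ltW.
rewrite (key c (ltW c0)) (key C (ltW C0)).
apply/andP; split; apply: (lee_wpmul2l ln0); apply: ge0_le_poweR => //.
- apply: mule_ge0; first by rewrite lee_fin.
  by apply: mule_ge0 => //; rewrite lee_fin mulr_ge0 ?(ltW c0) ?(ltW l0).
- by apply: lee_wpmul2l; rewrite ?lee_fin.
- by rewrite mule_ge0 ?lee_fin.
- by apply: lee_wpmul2l; rewrite ?lee_fin.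
Qed.

Lemma ae_cyl n (P : Rn R n -> Prop) : {ae lebesgue R n, forall x, P x} ->
  {ae lebesgue R n.+1, forall X, P (split_Rn X).1}.
Proof.
move=> [N [mN N0 PN]].
have [mC CE] := lebesgue_rectangle mN (@measurableT _ (measurableTypeR R)).
exists (split_Rn @^-1` (N `*` setT)); split => //.
  by rewrite [LHS]CE N0 mul0e.
by move=> X /= nP; split => //; apply: PN.
Qed.

(** The preimage of a null set under the projection is null. *)
Lemma lebesgue_function_cyl n (Q0 : set (Rn R n)) (I0 : set R)
    (f : Rn R n -> \bar R) (F : Rn R n.+1 -> \bar R) :
  measurable Q0 -> measurable I0 -> lebesgue_function Q0 f ->
  (forall x t, Q0 x -> I0 t -> F (pair_Rn x t) = f x) ->
  lebesgue_function (cyl Q0 I0) F.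
Proof.
move=> mQ0 mI0 [mf ff] FE.
have FE' X : cyl Q0 I0 X -> F X = f (split_Rn X).1.
  by rewrite -{1 2}(pair_split_Rn X) => /cyl_pair[]; exact: FE.
have mC : measurable (cyl Q0 I0) by have [] := lebesgue_rectangle mQ0 mI0.
split.
  apply: (eq_measurable_fun (fun X => f (split_Rn X).1)).
    by move=> X; rewrite inE => /FE'.
  apply: (measurable_comp mQ0 _ mf).
    by move=> _ [X [QX _] <-].
  by apply: measurable_funTS; exact: measurable_split_Rn1.
apply: filterS (ae_cyl ff) => X fX CX; rewrite FE'//; apply: fX.
by case: CX.
Qed.

(** [f] is replaced by a real function [g] that is measurable on the whole
    space and equal to [f] almost everywhere on [Q0]. *)
Lemma JNQ_term_lift n (p q alpha : R) :
  (1 <= n)%N -> (1 <= p)%R -> (1 <= q)%R ->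
  exists c C : R, [/\ (0 < c)%R, (0 < C)%R &
  forall (Q0 : set (Rn R n)) (I0 : set R)
    (f : Rn R n -> \bar R) (F : Rn R n.+1 -> \bar R),
  measurable Q0 -> measurable I0 -> lebesgue_function Q0 f ->
  (forall x t, Q0 x -> I0 t -> F (pair_Rn x t) = f x) ->
  forall Q l b0 b1 a, is_cube Q l -> Q `<=` Q0 -> side b0 b1 a l `<=` I0 ->
  (c * l)%:E * JNQ_term p q alpha f Q <=
    JNQ_term p q alpha F (cyl Q (side b0 b1 a l)) <=
  (C * l)%:E * JNQ_term p q alpha f Q].
Proof.
move=> n1 p1 q1.
have [c [C [c0 C0 H]]] := JNQ_term_compare alpha n1 p1 q1.
exists c, C; split => // Q0 I0 f F mQ0 mI0 lf FE Q l b0 b1 a cQ QQ0 sI0.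
have [mF _] := lebesgue_function_cyl mQ0 mI0 lf FE.
have [mf ff] := lf.
pose g x := fine ((f \_ Q0) x).
have mfQ : measurable_fun setT (f \_ Q0) by exact/(measurable_restrictT _ mQ0).
have mg : measurable_fun setT g.
  exact: (measurableT_comp (f := fine)).
have gf x : Q0 x -> f x \is a fin_num -> (g x)%:E = f x.
  by move=> Qx fx; rewrite /g patchE mem_set// fineK.
have [mQ _] := cube_measure cQ.
have mI : measurable (side b0 b1 a l) by exact: measurable_side.
have mC : measurable (cyl Q (side b0 b1 a l)) by have [] := lebesgue_rectangle mQ mI.
have -> : JNQ_term p q alpha f Q = JNQ_term p q alpha (EFin \o g) Q.
  rewrite /JNQ_term (@JNQ_energy_ae _ _ q alpha f (EFin \o g) Q mQ)//.
  - exact: measurable_funS mf.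
  - by apply/measurable_EFinP; exact: measurable_funTS.
  - by apply: filterS ff => x fx Qx; rewrite /= gf//; [exact: QQ0|exact/fx/QQ0].
have -> : JNQ_term p q alpha F (cyl Q (side b0 b1 a l)) =
    JNQ_term p q alpha (fun X => (g (split_Rn X).1)%:E) (cyl Q (side b0 b1 a l)).
  rewrite /JNQ_term (@JNQ_energy_ae _ _ q alpha F
    (fun X => (g (split_Rn X).1)%:E) _ mC)//.
  - apply: measurable_funS mF; first by have [] := lebesgue_rectangle mQ0 mI0.
    by move=> X [QX IX]; split; [exact: QQ0|exact: sI0].
  - apply/measurable_EFinP; apply: measurable_funTS.
    exact: (measurableT_comp mg (@measurable_split_Rn1 _ n)).
  - apply: filterS (ae_cyl ff) => X + [QX IX] => /(_ (QQ0 _ QX)) fX.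
    rewrite gf//; last exact: QQ0.
    rewrite -{1}(pair_split_Rn X) FE//; [exact: QQ0|exact: sI0].
exact: H.
Qed.

End lift.

(** * Families of cubes in a cylinder *)
Section families.
Context {R : realType}.
Local Notation mu := (@lebesgue_measure R).

(** For [T = JNQ_term p q alpha f] this is the [p]-th power of
    [JNQ_norm p q alpha Q0 f]. *)
Definition family_sup d (T : set (Rn R d) -> \bar R) (Q0 : set (Rn R d)) : \bar R :=
  ereal_sup [set (\esum_(Q in C) T Q)%E | C in subcube_collection Q0].

Lemma family_sup_ge0 d (T : set (Rn R d) -> \bar R) (Q0 : set (Rn R d)) :
  (0 <= family_sup T Q0)%E.
Proof.
apply: ereal_sup_ubound; exists set0; last exact: esum_set0.
by split.
Qed.

Lemma cyl_subset n (Q Q0 : set (Rn R n)) l b0 b1 (a : R) (I0 : set R) :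
  is_cube Q l -> cyl Q (side b0 b1 a l) `<=` cyl Q0 I0 ->
  Q `<=` Q0 /\ side b0 b1 a l `<=` I0.
Proof.
move=> cQ sub; have l0 : 0 < l by case: cQ.
have [x /interior_sub Qx] := cube_interior cQ.
have It : side b0 b1 a l (a + l / 2) by apply: in_side; lra.
split=> [y Qy|t Jt].
  have /sub/cyl_pair[] // : cyl Q (side b0 b1 a l) (pair_Rn y (a + l / 2)).
  exact/cyl_pair.
have /sub/cyl_pair[] // : cyl Q (side b0 b1 a l) (pair_Rn x t).
exact/cyl_pair.
Qed.

(** The data of a cube of R^(n+1) as a cylinder; they have to be chosen for all
    the cubes of a family at once. *)
Record block n := Block {
  bbase : set (Rn R n); blo : bool; bhi : bool; bpos : R; blen : R }.

Definition bcyl n (B : block n) : set (Rn R n.+1) :=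
  cyl (bbase B) (side (blo B) (bhi B) (bpos B) (blen B)).

Local Open Scope ereal_scope.

(** For every [t], the bases of the cubes of a finite family that meet the
    height [t] in the interior of their side have disjoint interiors, so that
    the sum of [T] over them is at most the supremum for [Q0]; the integral
    over [t] of this sum is the sum of [T] weighted by the edge lengths. *)
Lemma family_sup_cyl_le n (T : set (Rn R n) -> \bar R)
    (T' : set (Rn R n.+1) -> \bar R) (Q0 : set (Rn R n)) (t0 l0 C : R) :
  (0 < l0)%R -> (0 < C)%R -> (forall Q, 0 <= T Q) ->
  (forall Q l b0 b1 a, is_cube Q l -> Q `<=` Q0 ->
    side b0 b1 a l `<=` `[t0, (t0 + l0)%R] ->
    T' (cyl Q (side b0 b1 a l)) <= (C * l)%:E * T Q) ->
  family_sup T' (cyl Q0 `[t0, (t0 + l0)%R]) <= (C * l0)%:E * family_sup T Q0.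
Proof.
move=> l00 C0 T0 HT.
set I0 : set R := `[t0, (t0 + l0)%R]%classic.
have mI0 : measurable I0 by exact: measurable_itv.
apply: ge_ereal_sup => _ [F [HF HD] <-].
apply: ge_ereal_sup => _ [A [finA AF] <-].
have /choice[B HB] : forall X, exists b : block n, F X ->
    [/\ X = bcyl b, is_cube (bbase b) (blen b), bbase b `<=` Q0 &
      side (blo b) (bhi b) (bpos b) (blen b) `<=` I0].
  move=> X; have [FX|nFX] := pselect (F X); last first.
    by exists (Block set0 false false 0 0).
  have [[l /cube_cylP[Q [b0 [b1 [a [cQ XE]]]]]] sub] := HF X FX.
  have [QQ0 sI] : Q `<=` Q0 /\ side b0 b1 a l `<=` I0.
    by apply: (cyl_subset cQ); rewrite -XE.
  by exists (Block Q b0 b1 a l).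
(* Open intervals: t must be in the interior of the side, since closed sides of
   cubes with disjoint interiors may share an end point. *)
pose J X : set R := `](bpos (B X)), (bpos (B X) + blen (B X))%R[%classic.
have mJ X : measurable (J X) by exact: measurable_itv.
pose g X t : \bar R := T (bbase (B X)) * (\1_(J X) t)%:E.
have g0 X t : 0 <= g X t by rewrite mule_ge0.
have mind X : measurable_fun I0 (fun t => (\1_(J X) t)%:E : \bar R).
  by apply/measurable_EFinP.
have mg X : measurable_fun I0 (g X) by exact: measurable_funeM.
have gE X : F X -> \int[mu]_(t in I0) g X t = (blen (B X))%:E * T (bbase (B X)).
  move=> FX; have [XE cQ QQ0 sI] := HB X FX.
  have lX : (0 < blen (B X))%R by case: cQ.
  have indE : \int[mu]_(t in I0) (\1_(J X) t)%:E = mu (J X `&` I0).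
    exact: (@integral_indic _ (measurableTypeR R) R mu I0 mI0 (J X) (mJ X)).
  transitivity (T (bbase (B X)) * \int[mu]_(t in I0) (\1_(J X) t)%:E).
    by apply: (ge0_integralZl mu mI0 (mind X)).
  rewrite indE muleC; congr (_ * _).
  rewrite setIidl; last first.
    by move=> t Jt; apply/sI/in_side; move: Jt; rewrite /J/= in_itv.
  exact: itv_length.
apply: (@le_trans _ _ (\sum_(X \in A) C%:E * \int[mu]_(t in I0) g X t)).
  apply: lee_fsum => // X AX; have FX := AF X AX.
  have [XE cQ QQ0 sI] := HB X FX.
  rewrite gE// muleA -EFinM [X in T' X]XE; exact: HT.
rewrite -ge0_mule_fsumr; last by move=> X; apply: integral_ge0.
rewrite EFinM -muleA; apply: lee_wpmul2l; first by rewrite lee_fin ltW.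
rewrite -ge0_integral_fsum//.
apply: (@le_trans _ _ (\int[mu]_(t in I0) (cst (family_sup T Q0) t))); last first.
  by rewrite integral_cst//= [X in _ * X](itv_length _ _ _ l00) muleC.
apply: ge0_le_integral_nomeas => t It; first by apply: fsume_ge0.
pose At := A `&` [set X | J X t].
have finAt : finite_set At by exact: finite_setIl.
have -> : \sum_(X \in A) g X t = \sum_(X \in At) T (bbase (B X)).
  rewrite fsbig_mkcondr; apply: eq_fsbigr => X _; rewrite /g indicE.
  have -> : (t \in J X) = (X \in [set X0 | J X0 t]) by apply/idP/idP; rewrite !inE.
  by case: ifP => _; rewrite ?mule1 ?mule0.
(* In particular distinct cubes have distinct bases, as bases have nonempty
   interiors. *)
have Adisj X Y : At X -> At Y -> X <> Y ->
    disjoint_interiors (bbase (B X)) (bbase (B Y)).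
  move=> [/AF FX JX] [/AF FY JY] XY.
  have [XE cX _ _] := HB X FX; have [YE cY _ _] := HB Y FY.
  apply/disjoint_interiorsP => x iX iY.
  have /disjoint_interiorsP/(_ (pair_Rn x t)) := HD X Y FX FY XY; apply; first last.
  - by rewrite YE; apply: (cyl_interior (t := t) _ _ iY); move: JY; rewrite /J/= in_itv.
  - by rewrite XE; apply: (cyl_interior (t := t) _ _ iX); move: JX; rewrite /J/= in_itv.
have inj : set_inj At (fun X => bbase (B X)).
  move=> X Y /set_mem AX /set_mem AY XY; apply: contrapT => nXY.
  have := Adisj X Y AX AY nXY; rewrite XY => /disjoint_interiorsP H.
  have [_ cY _ _] := HB Y (AF _ AY.1).
  by have [x ix] := cube_interior cY; exact: (H x ix ix).
rewrite -(fsbig_image At (fun X => bbase (B X)) T inj) -esum_fset//; last exact: finite_image.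
apply: ereal_sup_ubound; exists ((fun X => bbase (B X)) @` At) => //.
split.
  move=> _ [X AX <-]; have [_ cX QX _] := HB X (AF _ AX.1).
  by split => //; exists (blen (B X)).
move=> _ _ [X AX <-] [Y AY <-] XY; apply: Adisj => // XY'.
by apply: XY; rewrite XY'.
Qed.

(** Above each cube of edge length [l] fit [N = floor (l0 / l)] copies, and
    [l0 <= 2 N l] since [N >= 1]. *)
Lemma family_sup_cyl_ge n (T : set (Rn R n) -> \bar R)
    (T' : set (Rn R n.+1) -> \bar R) (Q0 : set (Rn R n)) (t0 l0 c : R) :
  (0 < l0)%R -> (0 < c)%R -> (forall Q, 0 <= T Q) -> (forall X, 0 <= T' X) ->
  (forall Q l, is_cube Q l -> Q `<=` Q0 -> (l <= l0)%R) ->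
  (forall Q l b0 b1 a, is_cube Q l -> Q `<=` Q0 ->
    side b0 b1 a l `<=` `[t0, (t0 + l0)%R] ->
    (c * l)%:E * T Q <= T' (cyl Q (side b0 b1 a l))) ->
  (c / 2 * l0)%:E * family_sup T Q0 <= family_sup T' (cyl Q0 `[t0, (t0 + l0)%R]).
Proof.
move=> l00 c0 T0 T'0 Hl HT.
set I0 : set R := `[t0, (t0 + l0)%R]%classic.
pose k := (c / 2 * l0)%R.
have k0 : (0 < k)%R by rewrite mulr_gt0// divr_gt0.
rewrite -lee_pdivlMl//.
apply: ge_ereal_sup => _ [F [HF HD] <-].
apply: ge_ereal_sup => _ [A [finA AF] <-].
rewrite lee_pdivlMl// ge0_mule_fsumr// -esum_fset//; last first.
  by move=> Q _; rewrite mule_ge0// lee_fin ltW.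
have /choice[len Hlen] : forall Q, exists l, F Q -> is_cube Q l.
  move=> Q; have [FQ|nFQ] := pselect (F Q); last by exists 0%R.
  by have [[l cQ] _] := HF Q FQ; exists l.
pose N Q := Num.truncn (l0 / len Q)%R.
have NP Q : F Q -> ((N Q)%:R * len Q <= l0)%R /\ (l0 <= 2 * (N Q)%:R * len Q)%R.
  move=> FQ; have cQ := Hlen Q FQ; have lQ : (0 < len Q)%R by case: cQ.
  have lQ0 := Hl Q _ cQ (HF Q FQ).2.
  have q1 : (1 <= l0 / len Q)%R by rewrite ler_pdivlMr// mul1r.
  have q0 : (0 <= l0 / len Q)%R by lra.
  have /andP[h1 h2] := truncn_itv q0.
  have N1 : (1 <= (N Q)%:R :> R)%R.
    by rewrite ler1n /N -ltnS -(ltr_nat R); apply: le_lt_trans h2.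
  split; first by rewrite -ler_pdivlMr.
  rewrite -ler_pdivrMr//; apply/ltW/(lt_le_trans h2).
  by rewrite -natr1 -/(N Q); lra.
(* Half-open sides make the copies above the same cube disjoint. *)
pose phi (z : set (Rn R n) * nat) : set (Rn R n.+1) :=
  cyl z.1 (side true true (t0 + z.2%:R * len z.1)%R (len z.1)).
have sub Q i : F Q -> (i < N Q)%N ->
    side true true (t0 + i%:R * len Q)%R (len Q) `<=` I0.
  move=> FQ iN t; have lQ : (0 < len Q)%R by case: (Hlen Q FQ).
  rewrite /side /I0 /= !in_itv/= => /andP[u1 u2].
  have [h1 _] := NP Q FQ.
  have iN' : (i%:R + 1 <= (N Q)%:R :> R)%R by rewrite natr1 ler_nat.
  have i0 : (0 <= i%:R :> R)%R by [].
  by apply/andP; split; nra.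
apply: (@le_trans _ _ (\esum_(Q in A) \esum_(i in `I_(N Q)) T' (phi (Q, i)))).
  apply: le_esum => Q AQ; have FQ := AF Q AQ.
  have cQ := Hlen Q FQ; have lQ : (0 < len Q)%R by case: cQ.
  rewrite (esum_fset (finite_II (N Q)))//.
  rewrite -fsbig_ord.
  apply: (@le_trans _ _ (\sum_(i < N Q) (c * len Q)%:E * T Q)).
    rewrite sumr_const card_ord -[X in _ <= X]mule_natl muleA -EFinM.
    apply: lee_wpmul2r => //; rewrite lee_fin /k.
    have [_ h2] := NP Q FQ; nra.
  apply: lee_sum => i _; apply: HT => //; first exact: (HF Q FQ).2.
  exact: (sub Q i FQ (ltn_ord i)).
rewrite esum_esum//.
pose P := A `*`` (fun Q => `I_(N Q)).
rewrite -/P (eq_esum (b := fun z => T' (phi z))); last by case.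
have Pphi z : P z -> is_cube (phi z) (len z.1).
  by move=> [Az _]; apply: is_cube_cyl; apply: Hlen; exact: AF.
have Pdisj z w : P z -> P w -> z <> w -> disjoint_interiors (phi z) (phi w).
  case: z w => [Q i] [Q' i'] /= [AQ iN] [AQ' iN'] zw.
  apply/disjoint_interiorsP => X; rewrite -(pair_split_Rn X) /phi/=.
  move=> /cyl_interior_proj[iQ It] /cyl_interior_proj[iQ' It'].
  have [QQ'|QQ'] := pselect (Q = Q'); last first.
    have /disjoint_interiorsP := HD Q Q' (AF _ AQ) (AF _ AQ') QQ'.
    by apply; [exact: iQ|exact: iQ'].
  subst Q'; have lQ : (0 < len Q)%R by case: (Hlen Q (AF _ AQ)).
  move: It It'; rewrite /side /= !in_itv/= => /andP[u1 u2] /andP[u3 u4].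
  have [ii|ii|ii] := ltngtP i i'.
  - have : (i%:R + 1 <= i'%:R :> R)%R by rewrite natr1 ler_nat.
    by nra.
  - have : (i'%:R + 1 <= i%:R :> R)%R by rewrite natr1 ler_nat.
    by nra.
  - by apply: zw; rewrite ii.
have inj : set_inj P phi.
  move=> z w /set_mem Pz /set_mem Pw zw; apply: contrapT => nzw.
  have := Pdisj z w Pz Pw nzw; rewrite zw => /disjoint_interiorsP H.
  by have [x ix] := cube_interior (Pphi w Pw); exact: (H x ix ix).
rewrite -(esum_image P phi T' inj).
apply: ereal_sup_ubound; exists (phi @` P) => //; split.
  move=> _ [z Pz <-]; split; first by exists (len z.1); exact: Pphi.
  case: z Pz => Q i [/= AQ iN] X [QX IX]; split.
    by apply: (HF Q (AF _ AQ)).2.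
  by apply: (sub Q i) => //; exact: AF.
move=> _ _ [z Pz <-] [w Pw <-] zw; apply: Pdisj => // zw'.
by apply: zw; rewrite zw'.
Qed.

End families.

Lemma cube_length_le (R : realType) n (Q Q0 : set (Rn R n)) l l0 :
  (1 <= n)%N -> is_cube Q l -> is_cube Q0 l0 -> Q `<=` Q0 -> l <= l0.
Proof.
move=> n1 cQ cQ0 QQ0; have [mQ QE] := cube_measure cQ.
have [mQ0 Q0E] := cube_measure cQ0.
have : (lebesgue R n Q <= lebesgue R n Q0)%E by apply: le_measure; rewrite ?inE.
rewrite QE Q0E lee_fin ler_pXn2r// ?nnegrE ?ltW//; first by case: cQ.
by case: cQ0.
Qed.

Theorem proposition2p11 (R : realType) (n : nat) (p q alpha : R)
    (hn : (1 <= n)%N) (hp : 1 <= p) (hq : 1 <= q) :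
  exists c : R, 0 < c /\
    forall (Q0 : set (Rn R n)) (l0 t0 : R)
      (f : Rn R n -> \bar R) (F : Rn R n.+1 -> \bar R),
      is_cube Q0 l0 ->
      lebesgue_function Q0 f ->
      let Q0' := cylinder Q0 `[t0, t0 + l0] in
      (forall (x : Rn R n) (t : R), Q0' (pair_Rn x t) -> F (pair_Rn x t) = f x) ->
      [/\ lebesgue_function Q0' F,
          JNQ p q alpha Q0' F <-> JNQ p q alpha Q0 f,
          (c^-1%:E * JNQ_norm p q alpha Q0' F
             <= (l0 `^ p^-1)%:E * JNQ_norm p q alpha Q0 f)%E
        & ((l0 `^ p^-1)%:E * JNQ_norm p q alpha Q0 f
             <= c%:E * JNQ_norm p q alpha Q0' F)%E].
Proof.
have [c [C [c0 C0 H]]] := JNQ_term_lift alpha hn hp hq.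
have p0 : 0 < p by lra.
have p'0 : 0 <= p^-1 by rewrite invr_ge0 ltW.
have c20 : 0 < (c / 2)^-1 by rewrite invr_gt0 divr_gt0.
pose A := C `^ p^-1; pose B := (c / 2)^-1 `^ p^-1.
have A0 : 0 < A by exact: powR_gt0.
have B0 : 0 < B by exact: powR_gt0.
exists (A + B); split; first by rewrite addr_gt0.
move=> Q0 l0 t0 f F cQ0 lf Q0' FE.
have l00 : 0 < l0 by case: cQ0.
have [mQ0 _] := cube_measure cQ0.
pose I0 : set R := `[t0, (t0 + l0)%R]%classic.
have mI0 : measurable I0 by exact: measurable_itv.
have Q0'E : Q0' = cyl Q0 I0 by exact: cylinderE.
have FE' x t : Q0 x -> I0 t -> F (pair_Rn x t) = f x.
  by move=> Qx It; apply: FE; rewrite Q0'E; apply/cyl_pair.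
have lF : lebesgue_function Q0' F.
  by rewrite Q0'E; exact: lebesgue_function_cyl FE'.
have HT := H Q0 I0 f F mQ0 mI0 lf FE'.
pose S := family_sup (JNQ_term p q alpha f) Q0.
pose S' := family_sup (JNQ_term p q alpha F) Q0'.
have S0 : (0 <= S)%E by exact: family_sup_ge0.
have S'0 : (0 <= S')%E by exact: family_sup_ge0.
have T0 d (g : Rn R d -> \bar R) Q : (0 <= JNQ_term p q alpha g Q)%E.
  exact: JNQ_term_ge0.
have HS' : (S' <= (C * l0)%:E * S)%E.
  rewrite /S' Q0'E; apply: family_sup_cyl_le => // Q l b0 b1 a cQ QQ0 sI.
  by have /andP[] := HT Q l b0 b1 a cQ QQ0 sI.
have HS : ((c / 2 * l0)%:E * S <= S')%E.
  rewrite /S' Q0'E; apply: family_sup_cyl_ge => //.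
    by move=> Q l cQ QQ0; exact: (cube_length_le hn cQ cQ0 QQ0).
  move=> Q l b0 b1 a cQ QQ0 sI.
  by have /andP[] := HT Q l b0 b1 a cQ QQ0 sI.
have N1 : (JNQ_norm p q alpha Q0' F <=
    A%:E * ((l0 `^ p^-1)%:E * JNQ_norm p q alpha Q0 f))%E.
  have := ge0_le_poweR p'0 S'0 HS'.
  rewrite poweRM// ?lee_fin ?mulr_ge0 ?(ltW C0) ?(ltW l00)//.
  by rewrite poweR_EFin powRM ?(ltW C0) ?(ltW l00)// EFinM -muleA.
have N2 : ((l0 `^ p^-1)%:E * JNQ_norm p q alpha Q0 f <=
    B%:E * JNQ_norm p q alpha Q0' F)%E.
  have HS2 : (l0%:E * S <= (c / 2)^-1%:E * S')%E.
    by rewrite lee_pdivlMl ?divr_gt0// muleA -EFinM.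
  have := ge0_le_poweR p'0 _ HS2; rewrite !poweRM ?lee_fin ?(ltW l00) ?(ltW c20)//.
  by rewrite !poweR_EFin; apply; rewrite mule_ge0// lee_fin ltW.
have n0 : (0 <= JNQ_norm p q alpha Q0 f)%E by exact: poweR_ge0.
have n'0 : (0 <= JNQ_norm p q alpha Q0' F)%E by exact: poweR_ge0.
have lp0 : 0 < l0 `^ p^-1 by exact: powR_gt0.
split => //.
- split=> -[_ Noo]; split => //.
    have : ((l0 `^ p^-1)%:E * JNQ_norm p q alpha Q0 f < +oo)%E.
      apply: (le_lt_trans N2); apply: lte_mul_pinfty => //.
      by rewrite lee_fin ltW.
    rewrite !ltey; apply: contra => /eqP ->.
    by rewrite gt0_muley ?lte_fin.
  apply: (le_lt_trans N1); apply: lte_mul_pinfty => //.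
    by rewrite lee_fin ltW.
  by apply: lte_mul_pinfty => //; rewrite lee_fin ltW.
- rewrite lee_pdivrMl ?addr_gt0//; apply: (le_trans N1).
  apply: lee_wpmul2r; first by rewrite mule_ge0// lee_fin ltW.
  by rewrite lee_fin lerDl ltW.
- apply: (le_trans N2); apply: lee_wpmul2r => //.
  by rewrite lee_fin lerDr ltW.
Qed.
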